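(* Let $T$ be as in the context and let $\lambda$ be a cardinal with $|T|<\lambda=\lambda^{<\lambda}$. The following are equivalent: (i) $T$ is not nulldimensional over $P$; (ii) for some saturated $M\models T$ there is a non-algebraic $p\in S_*(M)$; (iii) $T$ has a Vaughtian pair over $P$; (iv) $T$ has a Vaughtian pair $(M,N)$ over $P$ with $P^M=P^N$ saturated of cardinality $\lambda$; (v) $T$ has a two-cardinal model of cardinality $>|T|$; (vi) $T$ has a two-cardinal model $M$ with $P^M$ saturated; (vii) $T$ has a two-cardinal model $M$ of type $(\lambda,\lambda^+)$ with $P^M$ saturated; (viii) $T$ has a $\lambda$-saturated two-cardinal model of type $(\lambda,\lambda^+)$.
   Context: Setting: $T$ is a complete first-order theory whose language contains a distinguished unary predicate $P$ and no function symbols (every subset is treated as a substructure), and $T$ implies $P$ is infinite. $\mathcal C$ is a monster model of $T$; all models are elementary submodels of $\mathcal C$. For a set $A$, $P^A=A\cap P^{\mathcal C}$, viewed as a substructure. Standing hypotheses: (1) every subset of $P^{\mathcal C}$ definable in $\mathcal C$ with parameters is definable with parameters from $P^{\mathcal C}$; (2) every subset of $P^{\mathcal C}$ that is $0$-definable in $\mathcal C$ is $0$-definable in the induced structure on $P^{\mathcal C}$; (3) $T$ has quantifier elimination. A set $A$ is complete if for every formula $\psi(\bar x,\bar y)$ and $\bar b\subseteq A$, if $\models(\exists \bar x\in P)\psi(\bar x,\bar b)$ then there is $\bar a\subseteq P\cap A$ with $\models\psi(\bar a,\bar b)$ (every model is complete). For complete $A$, $S_*(A)$ is the set of types $\mathrm{tp}(\bar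 c/A)$ ($\bar c$ a finite tuple) with $P\cap(A\cup\bar c)=P\cap A$ and $A\cup\bar c$ complete. $T$ is nulldimensional over $P$ if for every $M\models T$ every $p\in S_*(M)$ is algebraic (realized in $M$). A Vaughtian pair over $P$ is a pair $(M,N)$ of models with $M\prec N\prec\mathcal C$, $M\ne N$ and $P^M=P^N$. A two-cardinal model is $M\models T$ with $|T|\le|P^M|<|M|$; it has type $(\kappa,\mu)$ if $|P^M|=\kappa$ and $|M|=\mu$. *)

(* Defs.v *)
From mathcomp Require Import all_boot.
From mathcomp Require Import boolp classical_sets functions cardinality.

Set Implicit Arguments.
Unset Strict Implicit.
Unset Printing Implicit Defensive.

Local Open Scope classical_set_scope.
Local Open Scope card_scope.

(* A cardinal is presented by any type or set of that cardinality. *)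

Definition card_lt T U (A : set T) (B : set U) : Prop :=
  A #<= B /\ ~ (B #<= A).

(* |A| = |B|^+ : the cardinals below |A| are those of subsets of A, so the
   second clause says that no cardinal lies strictly between |B| and |A|. *)
Definition card_succ T U (A : set T) (B : set U) : Prop :=
  card_lt B A /\ forall A' : set T, A' `<=` A -> card_lt A' A -> A' #<= B.

(* |Lam| = |Lam|^{<|Lam|}, where |Lam|^{<|Lam|} is the supremum of the cardinals
   |Lam|^mu over mu < |Lam|; every such mu, and every candidate upper bound
   below |Lam|, is the cardinality of a subset of Lam. *)
Definition card_eq_weak_power (Lam : Type) : Prop :=
  (forall mu : set Lam, card_lt mu [set: Lam] ->
     [set: mu -> Lam] #<= [set: Lam]) /\
  (forall kap : set Lam,
     (forall mu : set Lam, card_lt mu [set: Lam] -> [set: mu -> Lam] #<= kap) ->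
     [set: Lam] #<= kap).

Record language := Language {
  rel_symb : Type;
  arity : rel_symb -> nat;
  Psymb : rel_symb;
  arity_Psymb : arity Psymb = 1
}.

(* [formula L n]: first-order L-formulas with free variables among x_i, i < n.
   [fAll] binds the variable with index 0 and shifts the others by one. *)
Inductive formula (L : language) : nat -> Type :=
| fFalse n : formula L n
| fEq n : 'I_n -> 'I_n -> formula L n
| fRel n (r : rel_symb L) : ('I_(arity r) -> 'I_n) -> formula L n
| fImp n : formula L n -> formula L n -> formula L n
| fAll n : formula L n.+1 -> formula L n.

Fixpoint quantifier_free L n (phi : formula L n) : bool :=
  match phi with
  | fImp _ phi1 phi2 => quantifier_free phi1 && quantifier_free phi2
  | fAll _ _ => false
  | _ => true
  end.

Record structure (L : language) := Structure {
  carrier :> Type;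
  carrier_inhabited : inhabited carrier;
  interp : forall r : rel_symb L, ('I_(arity r) -> carrier) -> Prop
}.

Definition vcons T n (x : T) (v : 'I_n -> T) : 'I_n.+1 -> T :=
  fun i => if unlift ord0 i is Some j then v j else x.

Definition vcat T k n (v : 'I_k -> T) (w : 'I_n -> T) : 'I_(k + n) -> T :=
  fun i => match fintype.split i with inl j => v j | inr j => w j end.

Definition tuple_in T (A : set T) n (v : 'I_n -> T) : Prop :=
  forall i, A (v i).

(* Truth of phi at v in the substructure of S with universe A (for v in A);
   truth in S itself is [holds setT]. *)
Fixpoint holds L (S : structure L) (A : set S) n (phi : formula L n) :
    ('I_n -> S) -> Prop :=
  match phi with
  | fFalse _ => fun=> False
  | fEq _ i j => fun v => v i = v j
  | fRel _ r t => fun v => interp (fun i => v (t i))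
  | fImp _ phi1 phi2 => fun v => holds A phi1 v -> holds A phi2 v
  | fAll _ phi1 => fun v => forall x, A x -> holds A phi1 (vcons x v)
  end.

Definition P_of L (S : structure L) : set S :=
  [set x | interp (r := Psymb L) (fun=> x)].
Arguments P_of {L} S.

Definition theory (L : language) := set (formula L 0).

Definition is_model L (T : theory L) (S : structure L) : Prop :=
  forall phi, T phi -> forall v : 'I_0 -> S, holds setT phi v.

Definition entails L (T : theory L) (phi : formula L 0) : Prop :=
  forall S : structure L, is_model T S ->
  forall v : 'I_0 -> S, holds setT phi v.

Definition complete_theory L (T : theory L) : Prop :=
  (exists S : structure L, is_model T S) /\
  (forall phi, entails T phi \/ entails T (fImp phi (fFalse L 0))).

Definition quantifier_elimination L (T : theory L) : Prop :=
  forall n (phi : formula L n), exists psi : formula L n,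
    quantifier_free psi /\
    forall S : structure L, is_model T S ->
    forall v : 'I_n -> S, holds setT phi v <-> holds setT psi v.

Definition implies_P_infinite L (T : theory L) : Prop :=
  forall S : structure L, is_model T S -> infinite_set (P_of S).

(* |T| is the number of formulas of the language, i.e. |L| + aleph_0. *)
Definition formulas L : set {n & formula L n} := setT.
Arguments formulas : clear implicits.

(* D is a k-ary relation on A, definable in the substructure with universe A
   with parameters from B (for B included in A). For B = set0 the parameter
   tuple is empty and this is 0-definability. *)
Definition definable L (S : structure L) (A B : set S) k
    (D : set ('I_k -> S)) : Prop :=
  exists n (phi : formula L (k + n)) (b : 'I_n -> S), tuple_in B b /\
    D = [set v | tuple_in A v /\ holds A phi (vcat v b)].

Definition P_relation L (S : structure L) k (D : set ('I_k -> S)) : Prop :=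
  forall v, D v -> tuple_in (P_of S) v.

Definition P_stably_embedded L (C : structure L) : Prop :=
  forall k (D : set ('I_k -> C)), P_relation D ->
    definable setT setT D -> definable setT (P_of C) D.

Definition P_induced_structure L (C : structure L) : Prop :=
  forall k (D : set ('I_k -> C)), P_relation D ->
    definable setT set0 D -> definable (P_of C) set0 D.

(* A formula in k free variables with parameters in S: the first k variables
   are free and the remaining ones are replaced by the parameters. *)
Record pformula L (S : structure L) k := PFormula {
  nparam : nat;
  pf_formula : formula L (k + nparam);
  params : 'I_nparam -> S
}.
Arguments params {L S k} p : rename.

Definition pholds L (S : structure L) (A : set S) k (psi : pformula S k)
    (a : 'I_k -> S) : Prop :=
  holds A (pf_formula psi) (vcat a (params psi)).

Definition over L (S : structure L) (B : set S) k (p : set (pformula S k)) :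
    Prop :=
  forall psi, p psi -> tuple_in B (params psi).

Definition realized_in L (S : structure L) (A : set S) k
    (p : set (pformula S k)) : Prop :=
  exists a : 'I_k -> S, tuple_in A a /\ forall psi, p psi -> pholds A psi a.

Definition finitely_satisfiable_in L (S : structure L) (A : set S) k
    (p : set (pformula S k)) : Prop :=
  forall p0, p0 `<=` p -> finite_set p0 -> realized_in A p0.

(* The substructure with universe A is |K|-saturated. *)
Definition card_saturated L (S : structure L) U (K : set U) (A : set S) : Prop :=
  forall B : set S, B `<=` A -> card_lt B K ->
  forall p : set (pformula S 1), over B p ->
    finitely_satisfiable_in A p -> realized_in A p.

Definition saturated L (S : structure L) (A : set S) : Prop :=
  card_saturated A A.

Definition elementary L (S : structure L) (A B : set S) : Prop :=
  A `<=` B /\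
  forall n (phi : formula L n) (v : 'I_n -> S), tuple_in A v ->
    (holds A phi v <-> holds B phi v).

Definition automorphism L (S : structure L) (g : S -> S) : Prop :=
  bijective g /\
  forall (r : rel_symb L) (v : 'I_(arity r) -> S),
    interp v <-> interp (fun i => g (v i)).

Definition strongly_homogeneous L (S : structure L) U (K : set U) : Prop :=
  forall (A : set S) (f : S -> S), card_lt A K ->
    (forall n (phi : formula L n) (v : 'I_n -> S), tuple_in A v ->
       (holds setT phi v <-> holds setT phi (fun i => f (v i)))) ->
    exists g, automorphism g /\ forall x, A x -> g x = f x.

Definition monster L (T : theory L) (Kap : Type) (C : structure L) : Prop :=
  [/\ is_model T C,
      card_saturated [set: Kap] [set: C]
    & strongly_homogeneous C [set: Kap]].

Section OverP.
Context (L : language) (C : structure L) (Kap : Type).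
Implicit Types A M N : set C.

Local Notation P := (P_of C).

(* The models: elementary submodels of C of cardinality < |Kap|. *)
Definition submodel M : Prop :=
  elementary M setT /\ card_lt M [set: Kap].

Definition complete_set A : Prop :=
  forall k n (psi : formula L (k + n)) (b : 'I_n -> C), tuple_in A b ->
    (exists a : 'I_k -> C, tuple_in P a /\ holds setT psi (vcat a b)) ->
    exists a : 'I_k -> C, tuple_in (P `&` A) a /\ holds setT psi (vcat a b).

Definition tp k (c : 'I_k -> C) A : set (pformula C k) :=
  [set psi | tuple_in A (params psi) /\ pholds setT psi c].

Definition S_star A k : set (set (pformula C k)) :=
  [set p | exists c : 'I_k -> C,
     [/\ p = tp c A, P `&` (A `|` range c) = P `&` A
       & complete_set (A `|` range c)]].

(* A type over a model is algebraic iff it is realized in that model. *)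
Definition algebraic_over M k (p : set (pformula C k)) : Prop :=
  exists a : 'I_k -> C, tuple_in M a /\ forall psi, p psi -> pholds setT psi a.

Definition nulldimensional : Prop :=
  forall M, submodel M -> forall k p, @S_star M k p -> algebraic_over M p.

Definition vaughtian_pair M N : Prop :=
  [/\ submodel M, submodel N, elementary M N, M <> N & P `&` M = P `&` N].

Definition two_cardinal M : Prop :=
  [/\ submodel M, formulas L #<= P `&` M & card_lt (P `&` M) M].

Definition of_type_succ (Lam : Type) M : Prop :=
  P `&` M #= [set: Lam] /\ card_succ M [set: Lam].

End OverP.

(* Main.v *)
Require Import Defs.
From Stdlib Require List.
From mathcomp Require Import all_boot.
From mathcomp Require Import boolp classical_sets functions cardinality wochoice.

Set Implicit Arguments.
Unset Strict Implicit.
Unset Printing Implicit Defensive.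

Local Open Scope classical_set_scope.
Local Open Scope card_scope.

(* If p = tp(c/M) in S_*(M) is non-algebraic, then playing according to c one
   survives any finite list of demands "avoid the element a" and "if
   theta(y, x, a) is solvable in P, commit to one solution y".  This is a statement about
   finite games on definable sets, hence first-order, so it passes from M to
   every model.  Over a complete set A of size lambda with P^A saturated of
   size lambda, stable embeddedness turns the search for the next y into the
   realization in P^A of a small type, so lambda many demands can be met one
   after the other; this yields c outside A with A u {c} complete and of the
   same P-part.  Dropping the demand "c is not in A", the same construction
   realizes every small type over A without enlarging P^A, so that A is
   contained in a saturated model of size lambda with the same P-part.  A
   maximal chain of such models has a union of size lambda^+.  Conversely a
   two-cardinal model contains, by Loewenheim-Skolem, the smaller half of a
   Vaughtian pair, whose larger half realizes a non-algebraic type in S_*. *)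

(** * Cardinals *)

(** A type over one model cannot itself be moved to another; what moves is each finite list of
    demands. With parameters quantified universally and committed solutions existentially, survival
    is a single sentence, and a non-algebraic type over any model makes it true. Compactness would
    then give solutions somewhere in [P], not in [A]: here saturation of [P^A] is required. As [P^A]
    stays the same throughout, it remains saturated even when [A] is an intermediate set that is
    complete but not a model.

    The equation [lambda = lambda^{<lambda}] enters twice. It makes [lambda] regular, so that small
    parameter sets appear at an early stage, and it bounds by [lambda] the number of small families
    of definable sets over a set of size at most [lambda], so that all of them can be scheduled.

    Unions of chains preserve completeness and the [P]-part but need not preserve saturation. Hence
    a chain with union of size at most [lambda] is prolonged by adding one element to the union and
    saturating again. *)

Definition tle (T U : Type) := exists f : T -> U, injective f.

Lemma tle_trans T U V : tle T U -> tle U V -> tle T V.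
Proof. by move=> [f fi] [g gi]; exists (g \o f); apply: inj_comp. Qed.

Lemma tle_refl T : tle T T. Proof. by exists id. Qed.

Lemma card_tleP T U (A : set T) (B : set U) : (A #<= B) <-> tle A B.
Proof.
split=> [/card_leP/injfunPex[f _ fi]|[f fi]].
  by exists f => x y; apply: fi; rewrite inE.
apply/card_leP/injfunPex; exists f => //; exact: in2W.
Qed.

Lemma tle_setT T : tle T [set: T] /\ tle [set: T] T.
Proof.
split; last by exists set_val; apply: val_inj.
by exists (fun x => SigSub (mem_set I : x \in [set: T])) => x y [].
Qed.

Lemma card_leTP T U (B : set U) : ([set: T] #<= B) <-> tle T B.
Proof.
have [h1 h2] := tle_setT T; rewrite card_tleP.
by split; apply: tle_trans.
Qed.

Lemma card_leTr T U (A : set T) : (A #<= [set: U]) <-> tle A U.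
Proof.
have [h1 h2] := tle_setT U; rewrite card_tleP.
by split=> h; apply: tle_trans h _.
Qed.

Lemma card_leTT T U : ([set: T] #<= [set: U]) <-> tle T U.
Proof.
by rewrite card_leTr; have [h1 h2] := tle_setT T; split; apply: tle_trans.
Qed.

Lemma tle_surj T U (f : U -> T) : (forall x, exists y, f y = x) -> tle T U.
Proof.
move=> /choice[g gK]; exists g => x y e; by rewrite -(gK x) -(gK y) e.
Qed.

Lemma tle_cover T U (A : set T) (f : U -> T) : (forall x, A x -> exists y,
    f y = x) -> tle A U.
Proof.
move=> h; have /choice[g gK] : forall x : A, exists y, f y = set_val x.
  by move=> x; apply: h; apply: set_valP.
by exists g => x y e; apply: val_inj; have := gK x; rewrite e gK.
Qed.

Lemma tle_prod T U T' U' : tle T T' -> tle U U' -> tle (T * U) (T' * U').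
Proof.
move=> [f fi] [g gi]; exists (fun x => (f x.1, g x.2)).
by move=> [x y] [x' y'] /= [/fi -> /gi ->].
Qed.

Lemma tle_sum T U T' U' : tle T T' -> tle U U' -> tle (T + U) (T' + U').
Proof.
move=> [f fi] [g gi].
exists (fun x => match x with inl x => inl (f x) | inr x => inr (g x) end).
by move=> [x|x] [y|y] //= [] => [/fi ->|/gi ->].
Qed.

(** A maximal partial injection, taken as a graph, is total or onto, since otherwise one more pair
    could be added. *)
Lemma tle_total T U : tle T U \/ tle U T.
Proof.
pose P (F : set (T * U)) :=
  (forall x y y', F (x, y) -> F (x, y') -> y = y') /\
  (forall x x' y, F (x, y) -> F (x', y) -> x = x').
have [|F [[F1 F2] Fmax]] := @Zorn_bigcup _ P.
  move=> FF FP Ft.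
  have tot p q : (\bigcup_(X in FF) X) p -> (\bigcup_(X in FF) X) q ->
      exists2 X, FF X & X p /\ X q.
    move=> [X FX Xp] [Y FY Yq].
    by have [s|s] := Ft _ _ FX FY;
        [exists Y => //; split=> //; apply: s|exists X => //; split => //; apply: s].
  split.
    by move=> x y y' h1 h2; have [X /FP[h _] [a b]] := tot _ _ h1 h2; apply: h a b.
  by move=> x y y' h1 h2; have [X /FP[_ h] [a b]] := tot _ _ h1 h2; apply: h a b.
have [dom|/existsNP[x0 nx0]] := pselect (forall x, exists y, F (x, y)).
  left; have [f fP] := choice dom; exists f => x x' e.
  by apply: F2 (fP x) _; rewrite e.
have [cod|/existsNP[y0 ny0]] := pselect (forall y, exists x, F (x, y)).
  right; have [f fP] := choice cod; exists f => x x' e.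
  by apply: F1 (fP x) _; rewrite e.
have nx y : ~ F (x0, y) by move=> h; apply: nx0; exists y.
have ny x : ~ F (x, y0) by move=> h; apply: ny0; exists x.
exfalso; apply: (Fmax (F `|` [set (x0, y0)])).
  split; first by move=> p Fp; left.
  by move=> h; apply: (nx y0); apply: h; right.
split=> x y z [h|E] [h'|E'].
- exact: F1 h h'.
- by case: E' h => -> _ /nx.
- by case: E h' => -> _ /nx.
- by case: E => _ ->; case: E'.
- exact: F2 h h'.
- by case: E' h => _ -> /ny.
- by case: E h' => _ -> /ny.
- by case: E E' => -> _ [->].
Qed.

Lemma tle_sq T : tle nat T -> tle (T * T) T.
Proof.
move=> [e ei].
pose D (F : set (T * T * T)) : set T := [set x | exists z, F ((x, x), z)].
pose valid (F : set (T * T * T)) := [/\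
  forall x y, D F x -> D F y -> exists z, F ((x, y), z),
  forall x y z, F ((x, y), z) -> [/\ D F x, D F y & D F z],
  forall p z z', F (p, z) -> F (p, z') -> z = z' &
  forall p p' z, F (p, z) -> F (p', z) -> p = p'].
pose P (F : set (T * T * T)) := valid F /\ (F = set0 \/ tle nat (D F)).
have [|F [[[F1 F2 F3 F4] F0] Fmax]] := @Zorn_bigcup _ P.
  move=> FF FP Ft; set G := \bigcup_(X in FF) X.
  have tot p q : G p -> G q -> exists2 X, FF X & X p /\ X q.
    move=> [X FX Xp] [Y FY Yq].
    by have [s|s] := Ft _ _ FX FY;
        [exists Y => //; split=> //; apply: s|exists X => //; split => //; apply: s].
  have DX X : FF X -> D X `<=` D G by move=> FX x [z Xz]; exists z; exists X.
  split; [split|].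
  - move=> x y [z Gx] [t Gy]; have [X FX [Xx Xy]] := tot _ _ Gx Gy.
    have [[/(_ x y) h _ _ _] _] := FP _ FX.
    by have [||u Xu] := h; [exists z|exists t|exists u, X].
  - move=> x y z [X FX Xp]; have [[_ /(_ _ _ _ Xp)[h1 h2 h3] _ _] _] := FP _ FX.
    by split; apply: DX FX _ _.
  - move=> p z z' Gx Gy; have [X FX [Xx Xy]] := tot _ _ Gx Gy.
    by have [[_ _ h _] _] := FP _ FX; apply: h Xx Xy.
  - move=> p z z' Gx Gy; have [X FX [Xx Xy]] := tot _ _ Gx Gy.
    by have [[_ _ _ h] _] := FP _ FX; apply: h Xx Xy.
  have [[X [FX nX]]|h] := pselect (exists X, FF X /\ X <> set0).
    right; have [_ [//|h]] := FP _ FX.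
    by apply: tle_trans h _; apply/card_tleP/subset_card_le/DX.
  left; apply/seteqP; split=> // p [X FX Xp]; apply: h.
  by exists X; split=> // X0; move: Xp; rewrite X0.
(* The empty graph is not maximal: [e] carries a pairing function on [nat] into [T]. *)
have {F0} natF : tle nat (D F).
  case: F0 => // F0; exfalso.
  have /card_leTT[u ui] : [set: nat * nat] #<= [set: nat].
    by move: card_nat2; rewrite card_eq_le => /andP[].
  pose G : set (T * T * T) := [set q | exists m n, q = ((e m, e n), e (u (m, n)))].
  have DG x : D G x <-> exists n, x = e n.
    split=> [[z [m [n [-> _ _]]]]|[n ->]]; first by exists m.
    by exists (e (u (n, n))), n, n.
  apply: (Fmax G).
    rewrite F0; split=> // h; have : G ((e 0, e 0), e (u (0, 0))) by exists 0, 0.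
    by move/h.
  split; [split|right].
  - by move=> x y /DG[m ->] /DG[n ->]; exists (e (u (m, n))), m, n.
  - move=> x y z [m [n [-> -> ->]]].
    by split; apply/DG; [exists m|exists n|exists (u (m, n))].
  - by move=> p z z' [m [n [-> ->]]] [m' [n' [/ei -> /ei -> ->]]].
  - by move=> p p' z [m [n [-> ->]]] [m' [n' [-> /ei/ui[-> ->]]]].
  have h n : e n \in D G by rewrite inE; apply/DG; exists n.
  by exists (fun n => SigSub (h n)) => m n [/ei].
set A := D F in F1 F2 natF *.
have /choice[f fP] (a : A * A) : exists z : A,
    F ((set_val a.1, set_val a.2), set_val z).
  case: a => -[x /= Ax] [y /= Ay].
  have [z Fz] := F1 x y (set_mem Ax) (set_mem Ay).
  have [_ _ Az] := F2 _ _ _ Fz.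
  by exists (SigSub (mem_set Az)).
have fi : injective f.
  move=> [x y] [x' y'] E; have := fP (x, y); rewrite E => h.
  by have [/val_inj -> /val_inj ->] := F4 _ _ _ h (fP (x', y')).
have [n ni] := natF.
pose c (b : bool) := n b.
have ci : injective c by move=> [] [] // /ni.
have AA : tle (A + A) A.
  exists (fun x => match x with inl x => f (c true, x) | inr x => f (c false, x) end).
  by move=> [x|x] [y|y] /fi [] // => [->|/ci|/ci|->].
have Tsum : tle T (A + ~` A).
  exists (fun x => match pselect (A x) with
    | left h => inl (SigSub (mem_set h)) | right h =>
        inr (SigSub (mem_set (h : (~` A) x))) end).
  by move=> x y; case: pselect => hx; case: pselect => hy //; case.
have AT : tle A T by exists set_val; apply: val_inj.
(* If the complement of [A] embeds in [A], then so does [T], by [A + A <= A]. Otherwise [h] puts a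
   copy of [A] into the complement, and [F] extends to the union of both: pairs not inside [A] take
   their values in the copy, so they never collide with values of [F]. *)
have [le|[h hi]] := tle_total (~` A) A.
  have TA : tle T A by apply: tle_trans Tsum (tle_trans (tle_sum (tle_refl A) le) AA).
  apply: tle_trans (tle_trans (tle_prod TA TA) _) AT; by exists f.
exfalso.
pose B := [set set_val (h a) | a in [set: A]].
have hA a : ~ A (set_val (h a)) by exact: (set_valP (h a)).
pose code (x : A + A) : T :=
    match x with inl a => set_val a | inr a => set_val (h a) end.
have codei : injective code.
  move=> [x|x] [y|y] /= E.
  - by rewrite (val_inj E).
  - by case: (hA y); rewrite -E; apply: set_valP.
  - by case: (hA x); rewrite E; apply: set_valP.
  - by rewrite (hi _ _ (val_inj E)).
pose dec (x : A + A) : A :=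
    match x with inl a => f (c true, a) | inr a => f (c false, a) end.
have deci : injective dec by move=> [x|x] [y|y] /fi [] // => [->|/ci|/ci|->].
pose isA (x : A + A) := if x is inl _ then true else false.
pose G : set (T * T * T) := F `|` [set q | exists x y, ~~ (isA x && isA y) /\
  q = ((code x, code y), code (inr (f (dec x, dec y))))].
have AorB x y : isA x && isA y -> A (code x) /\ A (code y).
  by case: x y => [x|x] [y|y] //= _; split; apply: set_valP.
have GF x y : exists t, G ((code x, code y), code t).
  case/boolP : (isA x && isA y) => xy.
    case: x y xy => [x|x] [y|y] // _; exists (inl (f (x, y))); left.
    exact: fP (x, y).
  by exists (inr (f (dec x, dec y))); right; exists x, y.
have DG x : D G x <-> exists a, x = code a.
  split=> [[z [Fz|[a [b [_ [-> _ _]]]]]]|[a ->]]; last 1 first.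
  - by have [t h1] := GF a a; exists (code t).
  - have Ax : A x by exists z.
    by exists (inl (SigSub (mem_set Ax))).
  - by exists a.
have FA x y t : F ((code x, code y), t) -> isA x && isA y.
  move=> /F2[]; case: x => x /=; last by move=> /hA.
  by case: y => y //= _ /hA.
have FA' p t : F (p, code (inr t)) -> False.
  by case: p => ? ? /F2[_ _] /hA.
apply: (Fmax G).
  split; first by move=> q Fq; left.
  move=> GsF; have : G ((code (inr (c true)), code (inr (c true))),
      code (inr (f (dec (inr (c true)), dec (inr (c true)))))).
    by right; exists (inr (c true)), (inr (c true)).
  by move=> /GsF/FA.
split; [split|].
- move=> x y /DG[a ->] /DG[b ->]; by have [t] := GF a b; exists (code t).
- move=> x y z [/F2[Ax Ay Az]|[a [b [_ [-> -> ->]]]]].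
    by split; apply/DG; [exists (inl (SigSub (mem_set Ax)))|exists (inl
        (SigSub (mem_set Ay)))|exists (inl (SigSub (mem_set Az)))].
  by split; apply/DG; [exists a|exists b|exists (inr (f (dec a, dec b)))].
- move=> p z z' [Fz|[a [b [ab E]]]] [Fz'|[a' [b' [ab' E']]]].
  + exact: F3 Fz Fz'.
  + by case: E' Fz ab' => -> _ /FA ->.
  + by case: E Fz' ab => -> _ /FA ->.
  + by case: E E' => -> -> [/codei -> /codei -> ->].
- move=> p p' z [Fz|[a [b [ab E]]]] [Fz'|[a' [b' [ab' E']]]].
  + exact: F4 Fz Fz'.
  + by case: E' Fz => _ -> /FA'.
  + by case: E Fz' => _ -> /FA'.
  + case: E E' => -> -> [-> ec]; have := codei (inr _) (inr _) ec.
    by move=> -[/fi[/deci -> /deci ->]].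
right; apply: tle_trans natF _; apply/card_tleP/subset_card_le => x [z Fz].
by exists z; left.
Qed.

(** The length is stored beside the iterated pairing, because the fold alone does not tell where a
    list ends. *)
Lemma tle_seq T : tle nat T -> tle (seq T) T.
Proof.
move=> nT; have [p pi] := tle_sq nT; have [e ei] := nT.
pose fold := foldr (fun x y => p (x, y)) (e 0).
exists (fun s => p (e (size s), fold s)) => s t /pi[/ei st].
elim: s t st => [|x s IH] [|y t] //= [st] /pi[-> /(IH _ st) ->] //.
Qed.

Lemma tle_prod_inf K T U : tle nat K -> tle T K -> tle U K -> tle (T * U) K.
Proof. by move=> nK TK UK; apply: tle_trans (tle_prod TK UK) (tle_sq nK). Qed.

Lemma tle_sum_inf K T U : tle nat K -> tle T K -> tle U K -> tle (T + U) K.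
Proof.
move=> nK [f fi] [g gi]; apply: tle_trans (tle_sq nK); have [e ei] := nK.
exists (fun x => match x with inl x => (e 0, f x) | inr x => (e 1, g x) end).
by move=> [x|x] [y|y] /= [] // => [/fi ->|/ei|/ei|/gi ->].
Qed.

Lemma tle_option_inf K T : tle nat K -> tle T K -> tle (option T) K.
Proof.
move=> nK TK; have [f fi] : tle (T + nat) K by exact: tle_sum_inf.
exists (fun x => if x is Some x then f (inl x) else f (inr 0)).
by move=> [x|] [y|] // /fi // [->].
Qed.

Lemma tle_seq_inf K T : tle nat K -> tle T K -> tle (seq T) K.
Proof.
by move=> nK [f fi]; apply: tle_trans (tle_seq nK); exists (map f); apply: inj_map.
Qed.

Lemma tle_setU1 K T (A : set T) x : tle nat K -> tle A K -> tle (A `|` [set x]) K.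
Proof.
move=> nK AK; have oK : tle (option A) K by exact: tle_option_inf.
apply: tle_trans oK.
apply: (tle_cover (f := fun y => if y is Some a then set_val a else x)).
by move=> y [Ay|->]; [exists (Some (SigSub (mem_set Ay)))|exists None].
Qed.

(** * Small sets and transfinite constructions *)

Definition strict_well_order T (R : T -> T -> Prop) :=
  [/\ well_founded R, forall x y z, R x y -> R y z -> R x z &
      forall x y, [\/ R x y, x = y | R y x]].

Lemma wf_minimal T (R : T -> T -> Prop) (A : set T) :
  well_founded R -> A !=set0 -> exists2 x, A x & forall y, R y x -> ~ A y.
Proof.
move=> wf [x Ax]; apply: contrapT => h.
suff : forall y, ~ A y by move/(_ x).
apply: (well_founded_ind wf) => y IH Ay; apply: h; by exists y.
Qed.

Lemma strict_well_order_exists T :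
  exists R : T -> T -> Prop, strict_well_order R.
Proof.
elim/Peq: T => T; have [R Rwo] := well_ordering_principle T.
have minP (A : set T) : A !=set0 -> exists2 z, A z & forall x, A x -> R z x.
  move=> [x Ax]; have [|z [[zA zmin] _]] := Rwo [pred x | `[< A x >]].
    by exists x; apply/asboolP.
  by exists z => [|y Ay]; [apply/asboolP|apply: zmin; apply/asboolP].
have anti x y : R x y -> R y x -> x = y.
  move=> xy yx; have xx z : R z z.
    by have [|z' -> /(_ z)] := minP [set z]; [exists z|apply].
  have [|z [_ zu]] := Rwo (pred2 x y); first by exists x; rewrite inE eqxx.
  transitivity z; [symmetry|]; apply: zu; split; rewrite ?inE ?eqxx ?orbT //.
    by move=> u; rewrite inE => /orP[]/eqP->.
  by move=> u; rewrite inE => /orP[]/eqP->.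
have tot x y : R x y \/ R y x.
  have [|z [->|->] h] := minP [set x; y]; first by exists x; left.
    by left; apply: h; right.
  by right; apply: h; left.
have tr x y z : R x y -> R y z -> R x z.
  move=> xy yz; have [|u] := minP [set u | [\/ u = x, u = y | u = z]].
    by exists x; constructor 1.
  case=> -> h; first by apply: h; constructor 3.
    have yx : R y x by apply: h; constructor 1.
    by rewrite (anti _ _ xy yx).
  have zy : R z y by apply: h; constructor 2.
  by rewrite -(anti _ _ yz zy).
exists (fun x y => R x y /\ x <> y); split.
- move=> x; apply: contrapT => nx.
  have [|z nz zmin] := minP [set z | ~ Acc (fun x y => R x y /\ x <> y) z].
    by exists x.
  apply: nz; constructor => y [yz ne]; apply: contrapT => ny; apply: ne.
  by apply: anti => //; apply: zmin.
- move=> x y z [xy nxy] [yz nyz]; split; first exact: tr yz.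
  by move=> e; apply: nyz; apply: anti => //; rewrite -e.
- move=> x y; have [->|ne] := pselect (x = y); first by constructor 2.
  have [h|h] := tot x y; [by constructor 1|constructor 3; split => //].
  exact: nesym.
Qed.

(** Take the least point whose initial segment is as large as [T], and pull the order back along an
    embedding into that segment; by minimality the new segments are smaller than [T]. If there is no
    such point, the given order already serves. *)
Lemma initial_well_order T : exists R : T -> T -> Prop,
  strict_well_order R /\ forall x, ~ tle T [set y | R y x].
Proof.
have [R Rwo] := strict_well_order_exists T; have [wf tr tot] := Rwo.
have [[x0 x0P]|no] := pselect (exists x, tle T [set y | R y x]); last first.
  by exists R; split=> // x; move/forallNP: no.
have [|x [h hi] xmin] := wf_minimal (A := [set x | tle T [set y | R y x]]) wf.
  by exists x0.
pose g y := set_val (h y).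
have gi : injective g by move=> y z /val_inj/hi.
exists (fun y z => R (g y) (g z)); split; first split.
- move=> y; move e : (g y) => u.
  elim/(well_founded_ind wf): u y e => u IH y e.
  by constructor => z; rewrite e => /IH; apply.
- by move=> a b c; apply: tr.
- by move=> a b; case: (tot (g a) (g b)) => [|/gi|];
    [constructor 1|constructor 2|constructor 3].
move=> y le; apply: (xmin (g y)); first exact: set_valP (h y).
apply: tle_trans le _.
exists (fun z => SigSub (mem_set (set_valP z) : g (set_val z) \in [set u | R u (g y)])).
by move=> a b [/gi/val_inj].
Qed.

(** Recursion by choice, where [Phi i] sees only earlier values. The conclusion is conditional
    because solvability at [i] depends on the earlier choices; it is established afterwards by
    induction along [R]. *)
Lemma wf_choice T (R : T -> T -> Prop) V (v0 : V)
    (Phi : T -> (T -> V) -> V -> Prop) :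
  well_founded R ->
  (forall i f g, (forall j, R j i -> f j = g j) -> Phi i f = Phi i g) ->
  exists d : T -> V, forall i, (exists v, Phi i d v) -> Phi i d (d i).
Proof.
move=> wf ext.
have /choice[E EP] (p : T * (T -> V)) :
    exists v, (exists v', Phi p.1 p.2 v') -> Phi p.1 p.2 v.
  by have [[v h]|h] := pselect (exists v', Phi p.1 p.2 v'); [exists v|exists v0].
(* Indices not below [i] receive the dummy [v0], which [ext] makes invisible to [Phi i]. *)
pose F i (rec : forall j, R j i -> V) : V :=
  E (i, fun j => if pselect (R j i) is left h then rec j h else v0).
have FE i f g : (forall j h, f j h = g j h) -> F i f = F i g.
  by move=> fg; congr (E (i, _)); apply/funext => j; case: pselect.
pose d := Fix wf (fun=> V) F.
exists d => i [v iv].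
have -> : d i = F i (fun j _ => d j) by rewrite /d Fix_eq.
have e : Phi i d = Phi i (fun j => if pselect (R j i) is left h then d j else v0).
  by apply: ext => j ji; case: pselect.
by rewrite e; apply: (EP (i, _)) => /=; exists v; rewrite -e.
Qed.

Section Small.
Variable Lam : Type.

Definition small T := ~ tle Lam T.

Lemma small_le T U : tle T U -> small U -> small T.
Proof. by move=> TU sU LT; apply: sU; apply: tle_trans TU. Qed.

Lemma small_leL T : small T -> tle T Lam.
Proof. by move=> sT; have [] := tle_total T Lam. Qed.

Lemma small_ltP T : small T <-> card_lt [set: T] [set: Lam].
Proof.
rewrite /card_lt !card_leTT; split=> [h|[]//]; split=> //; exact: small_leL.
Qed.

Lemma small_ltsP T (A : set T) : small A <-> card_lt A [set: Lam].
Proof.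
rewrite /card_lt card_leTr card_leTP.
by split=> [h|[]//]; split=> //; exact: small_leL.
Qed.

Variable N : Type.
Hypotheses (Ninf : tle nat N) (Nsmall : small N).

Lemma natLam : tle nat Lam.
Proof. apply: tle_trans Ninf (small_leL Nsmall). Qed.

(** Hessenberg's theorem applies to infinite types only; [N] takes over when [T] and [U] may be
    finite. *)
Lemma small_env T U : small T -> small U ->
  exists S, [/\ tle T S, tle U S, tle nat S & small S].
Proof.
move=> sT sU; have [S [TS US sS]] : exists S, [/\ tle T S, tle U S & small S].
  have [h|h] := tle_total T U; [exists U|exists T]; split=> //; exact: tle_refl.
have [h|h] := tle_total S N; [exists N|exists S]; split=> //.
- exact: tle_trans h.
- exact: tle_trans h.
- exact: tle_trans h.
Qed.

Lemma small_prod T U : small T -> small U -> small (T * U).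
Proof.
move=> sT sU; have [S [TS US nS sS]] := small_env sT sU.
exact: small_le (tle_trans (tle_prod TS US) (tle_sq nS)) sS.
Qed.

Lemma small_seq T : small T -> small (seq T).
Proof.
move=> sT; have [S [[f fi] _ nS sS]] := small_env sT sT.
by apply: small_le sS; apply: tle_trans (tle_seq nS); exists (map f); apply: inj_map.
Qed.

Lemma small_nat : small nat. Proof. exact: small_le Ninf Nsmall. Qed.

Lemma small_fin (T : finType) : small T.
Proof.
apply: small_le small_nat; exists (fun x : T => val (enum_rank x)).
by move=> x y /val_inj/enum_rank_inj.
Qed.

Lemma small_sum T U : small T -> small U -> small (T + U).
Proof.
move=> sT sU; have [S [[f fi] [g gi] _ sS]] := small_env sT sU.
apply: small_le (small_prod (@small_fin bool) sS).
exists (fun x => match x with inl x => (true, f x) | inr x => (false, g x) end).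
by move=> [x|x] [y|y] //= [] => [/fi ->|/gi ->].
Qed.

Lemma small_option T : small T -> small (option T).
Proof.
move=> sT; apply: small_le (small_sum sT (@small_fin unit)).
exists (fun x => if x is Some x then inl x else inr tt).
by move=> [x|] [y|] //= [->].
Qed.

Lemma small_setU T (A B : set T) : small A -> small B -> small (A `|` B).
Proof.
move=> sA sB; apply: small_le (small_sum sA sB).
apply: (@tle_cover _ _ _ (fun x => match x with inl x => set_val x | inr x =>
    set_val x end)).
by move=> x [Ax|Bx]; [exists (inl (SigSub (mem_set Ax)))|exists (inr
    (SigSub (mem_set Bx)))].
Qed.

Lemma small_sub T (A B : set T) : A `<=` B -> small B -> small A.
Proof. by move=> AB; apply: small_le; apply/card_tleP/subset_card_le. Qed.

Lemma small_range I T (f : I -> T) : small I -> small (range f).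
Proof.
by apply: small_le; apply: (tle_cover (f := f)) => x [i _ <-]; exists i.
Qed.

Lemma small_bigcup I T (F : I -> set T) :
  small I -> (forall i, tle (F i) nat) -> small (\bigcup_(i in [set: I]) F i).
Proof.
move=> sI FN; pose e i := projT1 (cid (FN i)).
have ei i : injective (e i) by exact: projT2 (cid (FN i)).
apply: small_le (small_prod sI small_nat).
have /choice[c cP] (x : \bigcup_(i in [set: I]) F i) : exists i, F i (set_val x).
  by have [i _ Fi] := set_valP x; exists i.
exists (fun x => (c x, e (c x) (SigSub (mem_set (cP x))))).
move=> x y [exy]; move: (cP x) (cP y); rewrite exy => cx cy /ei[] /val_inj //.
Qed.

Lemma LamLam : tle (Lam * Lam) Lam. Proof. exact: tle_sq natLam. Qed.

Hypothesis Lam_pow : forall mu : set Lam, small mu -> tle (mu -> Lam) Lam.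

Variable R : Lam -> Lam -> Prop.
Hypotheses (Rwo : strict_well_order R) (Rinit : forall i, small [set j | R j i]).

Lemma small_leseg j : small [set i | ~ R j i].
Proof.
apply: (@small_sub _ _ ([set i | R i j] `|` [set j])).
  have [_ _ tot] := Rwo.
  by move=> i nji; case: (tot i j) => [||//]; [left|right].
apply: small_setU => //; apply: small_le small_nat.
by exists (fun=> 0) => x y _; apply: val_inj; rewrite /= (set_valP x) (set_valP y).
Qed.

(* Koenig's argument: an unbounded family of length < |Lam| would present Lam
   as a small union of small sets, and one diagonalizes against Lam^I <= Lam. *)
Lemma Lam_regular I (b : I -> Lam) : small I -> exists j, forall i, R (b i) j.
Proof.
move=> sI; apply: contrapT => nob.
have cof j : exists2 x, (range b) x & ~ R x j.
  apply: contrapT => h; apply: nob; exists j => i; apply: contrapT => nR.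
  by apply: h; exists (b i) => //; exists i.
have [F Fi] := Lam_pow (small_range (f := b) sI).
have /choice[g gP] (x : range b) :
    exists y, forall f, ~ R (set_val x) (F f) -> f x <> y.
  apply: contrapT => h.
  have /choice[f fP] y : exists f, ~ R (set_val x) (F f) /\ f x = y.
    apply: contrapT => h'; apply: h; exists y => f h1 h2.
    by apply: h'; exists f.
  apply: (small_leseg (j := set_val x)).
  exists (fun y => SigSub (mem_set ((fP y).1 : [set i | ~ R (set_val x) i] (F (f y))))).
  move=> y z [/Fi e]; by rewrite -(fP y).2 e (fP z).2.
have [x bx nx] := cof (F g).
by apply: (gP (SigSub (mem_set bx)) g nx).
Qed.

Lemma Lam_two : exists l0 l1 : Lam, l0 <> l1.
Proof. by have [e ei] := natLam; exists (e 0), (e 1) => /ei. Qed.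

(** By regularity a small subset is bounded, so it is determined by a bound and a two-valued
    function on the segment below it; [Lam_pow] allows at most [|Lam|] functions for each bound. *)
Lemma small_subsets V : tle V Lam ->
  exists e : Lam -> set V, forall D : set V, small D -> exists k, e k = D.
Proof.
move=> [v vi]; have [l0 [l1 l01]] := Lam_two.
pose F j := projT1 (cid (Lam_pow (Rinit (i := j)))).
have Fi j : injective (F j) by exact: projT2 (cid _).
have [q qi] := LamLam.
have /choice[bd bdP] (D : set V) : exists j, small D -> forall x, D x -> R (v x) j.
  have [sD|] := pselect (small D); last by exists l0.
  have [j jP] := Lam_regular (fun x : D => v (set_val x)) sD.
  by exists j => _ x Dx; apply: (jP (SigSub (mem_set Dx))).
pose ch (D : set V) j : [set i | R i j] -> Lam :=
  fun i => if pselect (exists2 x, D x & v x = set_val i) then l1 else l0.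
pose code D := q (bd D, F (bd D) (ch D (bd D))).
have chE D D' j : (forall x, D x -> R (v x) j) -> ch D j = ch D' j -> D `<=` D'.
  move=> Dj e x Dx; have Rj : [set i | R i j] (v x) by exact: Dj.
  have := congr1 (fun f : [set i | R i j] -> Lam => f (SigSub (mem_set Rj))) e.
  rewrite /ch; case: pselect => [h1|[]]; last by exists x.
  by case: pselect => [[y Dy /= /vi <-]|_ /esym /l01].
have codei (D D' : set V) : small D -> small D' -> code D = code D' -> D = D'.
  move=> sD sD' E0; have [ebd E] := qi _ _ E0; have h := bdP _ sD; have h' := bdP _ sD'.
  rewrite -ebd in E h'; have e := Fi _ _ _ E; apply/seteqP; split;
      [exact: chE h e|exact: chE h' (esym e)].
have /choice[e eP] k : exists D : set V,
    (exists D : set V, small D /\ code D = k) -> small D /\ code D = k.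
  by have [[D h]|h] := pselect (exists D : set V, small D /\ code D = k);
      [exists D|exists set0].
exists e => D sD; exists (code D).
have [|s1 s2] := eP (code D); first by exists D.
exact: codei.
Qed.

(** The third coordinate of a triple repeats each pair [|Lam|] many times, while the indices not
    above [j] form a small set; so some repetition comes after [j]. *)
Lemma bookkeeping : exists p : Lam -> Lam * Lam,
  forall j k, exists2 i, R j i & p i = (j, k).
Proof.
have [q qi] : tle (Lam * Lam * Lam) Lam.
  exact: tle_trans (tle_prod LamLam (tle_refl Lam)) LamLam.
have [l0 [l1 l01]] := Lam_two.
have /choice[p pP] i : exists r, forall j k l, i = q (j, k, l) -> r = (j, k).
  have [[[[j k] l] e]|h] := pselect (exists t, i = q t).
    by exists (j, k) => j' k' l'; rewrite e => /qi[-> -> _].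
  by exists (l0, l0) => j k l e; case: h; exists (j, k, l).
exists p => j k.
suff [l jl] : exists l, R j (q (j, k, l)) by exists (q (j, k, l)) => //; apply: pP.
apply: contrapT => h; apply: (small_leseg (j := j)).
have h' l : [set i | ~ R j i] (q (j, k, l)) by move=> /= c; apply: h; exists l.
by exists (fun l => SigSub (mem_set (h' l))) => l l' [/qi[]].
Qed.

(* Membership in I is tested on finite subsets, hence survives limit stages. *)
Lemma Lam_construction V (J : seq V -> Prop) (Req : Lam -> V -> Prop)
    (I := fun p : set V => forall s, List.Forall p s -> J s) :
  (forall (p : set V) i, small p -> I p -> exists v, Req i v /\ I (p `|` [set v])) ->
  forall p0 : set V, small p0 -> I p0 ->
  exists p : set V, [/\ p0 `<=` p, I p, forall v, p v -> p0 v \/ exists i, Req i v &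
    forall i, exists2 v, p v & Req i v].
Proof.
move=> step p0 sp0 Ip0; have [wf tr tot] := Rwo; have [l0 _] := Lam_two.
have [v0 _] := step p0 l0 sp0 Ip0.
pose st (d : Lam -> V) i := p0 `|` [set d j | j in [set j | R j i]].
have [|d dP] := wf_choice (R := R) v0 (Phi :=
    fun i d v => Req i v /\ I (st d i `|` [set v])) wf.
  move=> i f g fg; apply/funext => v; congr (_ /\ I ((_ `|` _) `|` _)).
  by apply/seteqP; split=> _ [j ji <-]; exists j => //; rewrite fg.
have sst i : small (st d i).
  apply: small_setU => //.
  apply: small_le (Rinit (i := i)).
  apply: (tle_cover (f := fun j : [set j | R j i] => d (set_val j))) => _ [j ji <-].
  by exists (SigSub (mem_set ji)).
have fin (Q : set Lam) s : (forall i j, Q j -> R i j -> Q i) ->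
    List.Forall (p0 `|` [set d j | j in Q]) s ->
    List.Forall p0 s \/ exists2 i, Q i & List.Forall (st d i `|` [set d i]) s.
  move=> Qd; elim: s => [|x s IH]; first by left; constructor.
  move=> /List.Forall_cons_iff[xP /IH sP].
  have stS i j y : R i j -> (st d i `|` [set d i]) y -> st d j y.
    move=> ij [[p0y|[k ki <-]]|->]; [by left|right|right].
      by exists k => //; apply: tr ki ij.
    by exists i.
  case: xP => [p0x|[j Qj <-]].
    case: sP => [sp|[i Qi si]]; [left|right; exists i => //]; constructor => //.
    by left; left.
  case: sP => [sp|[i Qi si]]; right.
    exists j => //; constructor; first by right.
    by apply: List.Forall_impl sp => y p0y; left; left.
  have [ij|e|ji] := tot i j.
  - exists j => //; constructor; first by right.
    by apply: List.Forall_impl si => y yi; left; apply: stS ij yi.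
  - by exists j => //; rewrite e in si *; constructor => //; right.
  - exists i => //; constructor; last by [].
    by left; right; exists j.
have good : forall i, Req i (d i) /\ I (st d i `|` [set d i]).
  apply: (well_founded_ind wf) => i IH; apply: dP; apply: step => // s.
  move=> /fin[|sp|[j ji sj]]; first by move=> a b /= bi ab; apply: tr ab bi.
    exact: Ip0.
  exact: (IH j ji).2.
exists (p0 `|` range d); split.
- by move=> x; left.
- move=> s /fin[//|sp|[j _ sj]]; first exact: Ip0.
  exact: (good j).2.
- by move=> v [|[i _ <-]]; [left|right; exists i; exact: (good i).1].
- by move=> i; exists (d i); [right; exists i|exact: (good i).1].
Qed.

End Small.
Arguments small_fin {Lam N} Ninf Nsmall T.

(** * Definability *)

Lemma eq_iff (Q Q' : Prop) : Q = Q' -> (Q <-> Q').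
Proof. by move=> ->. Qed.

Section Renaming.
Context (L : language).

Definition lift_ren n m (f : 'I_n -> 'I_m) : 'I_n.+1 -> 'I_m.+1 :=
  fun i => if unlift ord0 i is Some j then lift ord0 (f j) else ord0.

Fixpoint ren n (phi : formula L n) : forall m, ('I_n -> 'I_m) -> formula L m :=
  match phi with
  | fFalse _ => fun m _ => fFalse L m
  | fEq _ i j => fun m f => fEq L (f i) (f j)
  | fRel _ r t => fun m f => fRel (fun i => f (t i))
  | fImp _ phi1 phi2 => fun m f => fImp (ren phi1 f) (ren phi2 f)
  | fAll _ phi1 => fun m f => fAll (ren phi1 (lift_ren f))
  end.

Lemma vcons0 T n (x : T) (v : 'I_n -> T) : vcons x v ord0 = x.
Proof. by rewrite /vcons unlift_none. Qed.

Lemma vconsS T n (x : T) (v : 'I_n -> T) i : vcons x v (lift ord0 i) = v i.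
Proof. by rewrite /vcons liftK. Qed.

Lemma vcons_eta T n (a : 'I_n.+1 -> T) :
  a = vcons (a ord0) (fun i => a (lift ord0 i)).
Proof.
by apply/funext => i; case: (unliftP ord0 i) => [j ->|->]; rewrite ?vcons0 ?vconsS.
Qed.

Lemma vcat_l T k n (v : 'I_k -> T) (w : 'I_n -> T) i : vcat v w (lshift n i) = v i.
Proof. by rewrite /vcat -[lshift n i]/(unsplit (inl i)) unsplitK. Qed.

Lemma vcat_r T k n (v : 'I_k -> T) (w : 'I_n -> T) i : vcat v w (rshift k i) = w i.
Proof. by rewrite /vcat -[rshift k i]/(unsplit (inr i)) unsplitK. Qed.

Lemma vcons_lift_ren T n m (f : 'I_n -> 'I_m) (x : T) v :
  (fun i => vcons x v (lift_ren f i)) = vcons x (fun i => v (f i)).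
Proof.
apply/funext => i; rewrite /lift_ren {2}/vcons.
by case: unlift => [j|]; rewrite ?vconsS ?vcons0.
Qed.

Lemma holds_ren (S : structure L) (A : set S) n (phi : formula L n) m
    (f : 'I_n -> 'I_m) v :
  holds A (ren phi f) v <-> holds A phi (fun i => v (f i)).
Proof.
elim: phi m f v => {n} [n|n i j|n r t|n p1 IH1 p2 IH2|n p IH] m f v //=.
  by rewrite IH1 IH2.
by split=> h x Ax; have := h x Ax; rewrite IH vcons_lift_ren.
Qed.

End Renaming.

Section Definability.
Context (L : language) (C : structure L).
Implicit Types (A B Z : set C).
Local Notation P := (P_of C).

Definition env B V (v : V -> C) (x : V + B) : C :=
  match x with inl a => v a | inr b => set_val b end.

(* The variables are indexed by an arbitrary type V, and [inr b] is the
   parameter b: definability is then closed under the connectives, quantifiers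
   and substitutions without any bookkeeping on lists of variables. *)
Definition Def B V (D : (V -> C) -> Prop) : Prop :=
  exists n (phi : formula L n) (s : 'I_n -> V + B),
    forall v, D v <-> holds setT phi (fun i => env v (s i)).

Lemma Def_ext B V (D D' : (V -> C) -> Prop) :
  (forall v, D v <-> D' v) -> Def B D -> Def B D'.
Proof.
by move=> DD' [n [phi [s h]]]; exists n, phi, s => v; rewrite -DD'.
Qed.

Lemma Def_subst B V W (f : V -> W + B) (D : (V -> C) -> Prop) :
  Def B D -> Def B (fun w => D (fun a => env w (f a))).
Proof.
move=> [n [phi [s h]]].
exists n, phi, (fun i => match s i with inl a => f a | inr b => inr b end) => w.
rewrite h; set v1 := fun i => _; set v2 := fun i => _; suff -> : v1 = v2 by [].
by apply/funext => i; rewrite /v1 /v2; case: (s i).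
Qed.

Lemma Def_ren B V W (f : V -> W) (D : (V -> C) -> Prop) :
  Def B D -> Def B (fun w => D (fun a => w (f a))).
Proof. exact: (@Def_subst B V W (fun a => inl (f a))). Qed.

Lemma Def_mono A B V (D : (V -> C) -> Prop) : A `<=` B -> Def A D -> Def B D.
Proof.
move=> AB [n [phi [s h]]].
have AB' (a : A) : set_val a \in B by apply/mem_set/AB/set_valP.
exists n, phi, (fun i => match s i with inl a => inl a | inr b =>
    inr (SigSub (AB' b)) end) => w.
rewrite h; set v1 := fun i => _; set v2 := fun i => _; suff -> : v1 = v2 by [].
by apply/funext => i; rewrite /v1 /v2; case: (s i).
Qed.

Lemma Def_formula B n (phi : formula L n) : Def B (fun v => holds setT phi v).
Proof. by exists n, phi, (fun i => inl i). Qed.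

Lemma Def_eq B V (a b : V) : Def B (fun v => v a = v b).
Proof.
exists 2, (fEq L ord0 (lift ord0 ord0)), (vcons (inl a) (fun=> inl b)) => v /=.
by rewrite vcons0 vconsS.
Qed.

Lemma Def_P B V (a : V) : Def B (fun v => P (v a)).
Proof. by exists 1, (fRel (r := Psymb L) (fun=> ord0)), (fun=> inl a). Qed.

Lemma Def_imp B V (D1 D2 : (V -> C) -> Prop) :
  Def B D1 -> Def B D2 -> Def B (fun v => D1 v -> D2 v).
Proof.
move=> [n [p [s h]]] [n' [p' [s' h']]].
exists (n + n'), (fImp (ren p (@lshift n n')) (ren p' (@rshift n n'))),
    (vcat s s') => v.
rewrite h h' /= !holds_ren.
have -> : (fun i => env v (vcat s s' (lshift n' i))) = (fun i => env v (s i)).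
  by apply/funext => i; rewrite vcat_l.
by have -> : (fun i => env v (vcat s s' (rshift n i))) = (fun i => env v (s' i))
  by apply/funext => i; rewrite vcat_r.
Qed.

Lemma Def_false B V : Def B (fun _ : V -> C => False).
Proof. by exists 0, (fFalse L 0),
    (fun i : 'I_0 => match notF (ltn_ord i) with end). Qed.

Lemma Def_not B V (D : (V -> C) -> Prop) : Def B D -> Def B (fun v => ~ D v).
Proof. move=> h; exact: Def_imp h (Def_false B V). Qed.

Lemma Def_and B V (D1 D2 : (V -> C) -> Prop) :
  Def B D1 -> Def B D2 -> Def B (fun v => D1 v /\ D2 v).
Proof.
move=> h1 h2; apply: Def_ext (Def_not (Def_imp h1 (Def_not h2))) => v.
by split=> [h|[a b] h]; [apply: contrapT => k; apply: h => a b; apply: k|exact: h].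
Qed.

Lemma Def_or B V (D1 D2 : (V -> C) -> Prop) :
  Def B D1 -> Def B D2 -> Def B (fun v => D1 v \/ D2 v).
Proof.
move=> h1 h2; apply: Def_ext (Def_imp (Def_not h1) h2) => v.
by have [a|a] := pselect (D1 v); tauto.
Qed.

Lemma Def_true B V : Def B (fun _ : V -> C => True).
Proof. by apply: Def_ext (Def_not (Def_false B V)) => v; tauto. Qed.

Lemma Def_iff B V (D1 D2 : (V -> C) -> Prop) :
  Def B D1 -> Def B D2 -> Def B (fun v => D1 v <-> D2 v).
Proof. by move=> h1 h2; apply: Def_and; apply: Def_imp. Qed.

Definition ocons V (x : C) (v : V -> C) (o : option V) : C :=
  if o is Some a then v a else x.

Lemma Def_all B V (F : C -> (V -> C) -> Prop) :
  Def B (fun u : option V -> C => F (u None) (fun a => u (Some a))) ->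
  Def B (fun v => forall x, F x v).
Proof.
move=> [n [p [s h]]].
(* Slots of the bound variable still need some value in the reindexed valuation; [t] is that dummy.
   It is missing only if every slot is bound, and then the quantified formula gets no free variables
   at all. *)
have [t tP] : exists t : option (V + B), (exists i, s i <> inl None) -> t <> None.
  have [[i]|no] := pselect (exists i, s i <> inl None); last by exists None.
  by case: (s i) => [[a|]|b] // _; [exists (Some (inl a))|exists (Some (inr b))].
case: t tP => [t|] tP; last first.
  have sN i : s i = inl None.
    by apply: contrapT => h'; apply: tP => //; exists i.
  exists 0, (fAll (ren p (fun=> ord0))),
      (fun i : 'I_0 => match notF (ltn_ord i) with end) => v /=.
  have e x : F x v <-> holds setT (ren p (fun=> ord0)) (vcons x
      (fun i : 'I_0 => env v match notF (ltn_ord i) with end)).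
    rewrite -[F _ _]/(F (ocons x v None) (fun a => ocons x v (Some a))) h holds_ren.
    by apply: eq_iff; congr holds; apply/funext => i; rewrite sN vcons0.
  by split=> k x; [move=> _|]; apply/e; apply: k.
pose s' i := match s i with inl None => t | inl (Some a) => inl a | inr b => inr b end.
pose f i := match s i with inl None => ord0 | _ => lift ord0 i end.
exists n, (fAll (ren p f)), s' => v /=.
have e x : F x v <-> holds setT (ren p f) (vcons x (fun i => env v (s' i))).
  rewrite -[F _ _]/(F (ocons x v None) (fun a => ocons x v (Some a))) h holds_ren.
  apply: eq_iff; congr holds; apply/funext => i; rewrite /f /s'.
  by case E : (s i) => [[a|]|b]; rewrite ?vcons0 ?vconsS ?E.
by split=> k x; [move=> _|]; apply/e; apply: k.
Qed.

Lemma Def_ex B V (F : C -> (V -> C) -> Prop) :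
  Def B (fun u : option V -> C => F (u None) (fun a => u (Some a))) ->
  Def B (fun v => exists x, F x v).
Proof.
move=> h; apply: Def_ext (Def_not (Def_all (F := fun x v => ~ F x v) (Def_not h))) => v.
split=> [k|[x Fx] k]; last exact: (k x).
by apply: contrapT => k'; apply: k => x Fx; apply: k'; exists x.
Qed.

Lemma Def_allt B m V (F : ('I_m -> C) -> (V -> C) -> Prop) :
  Def B (fun u : 'I_m + V -> C => F (fun i => u (inl i)) (fun a => u (inr a))) ->
  Def B (fun v => forall x, F x v).
Proof.
elim: m V F => [|m IH] V F h.
  pose f (x : 'I_0 + V) : V :=
      match x with inl i => match notF (ltn_ord i) with end | inr a => a end.
  apply: Def_ext (Def_ren f h) => v; split=> [k x|]; last exact.
  move: k; rewrite /f /=; set g := fun i => _; suff -> : g = x by [].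
  by apply/funext => -[].
pose f (x : 'I_m.+1 + V) : 'I_m + option V := match x with
  | inl i => if unlift ord0 i is Some j then inl j else inr None
  | inr a => inr (Some a) end.
have h' := Def_ren f h.
apply: (@Def_ext _ _ (fun v => forall x (a : 'I_m -> C), F (vcons x a) v)).
  by move=> v; split=> k a; [rewrite (vcons_eta a)|move=> a'].
apply: (@Def_all B V (fun x v => forall a : 'I_m -> C, F (vcons x a) v)).
apply: (IH _ (fun a (u : option V -> C) => F (vcons (u None) a) (fun b => u (Some b)))).
apply: Def_ext h' => u; apply: eq_iff; congr (F _ _).
by apply/funext => i; rewrite /f /vcons; case: unlift.
Qed.

Lemma Def_ext_t B m V (F : ('I_m -> C) -> (V -> C) -> Prop) :
  Def B (fun u : 'I_m + V -> C => F (fun i => u (inl i)) (fun a => u (inr a))) ->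
  Def B (fun v => exists x, F x v).
Proof.
move=> h; apply: Def_ext (Def_not (Def_allt (F :=
    fun x v => ~ F x v) (Def_not h))) => v.
split=> [k|[x Fx] k]; last exact: (k x).
by apply: contrapT => k'; apply: k => x Fx; apply: k'; exists x.
Qed.

Lemma Def_tuple_in B Z m V (f : 'I_m -> V) :
  (forall W (a : W), Def B (fun w => Z (w a))) ->
  Def B (fun v => tuple_in Z (fun i => v (f i))).
Proof.
move=> DZ; elim: m f => [|m IH] f.
  by apply: Def_ext (Def_true B V) => v; split=> // _ [].
apply: Def_ext (Def_and (DZ _ (f ord0)) (IH (fun i => f (lift ord0 i)))) => v.
split=> [[h0 h] i|h]; last by split=> // i; exact: h.
by case: (unliftP ord0 i) => [j ->|->].
Qed.

Lemma Def_relativized B Z n (phi : formula L n) :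
  (forall W (a : W), Def B (fun w => Z (w a))) -> Def B (fun v => holds Z phi v).
Proof.
move=> DZ; elim: phi => {n} [n|n i j|n r t|n p1 IH1 p2 IH2|n p IH] /=.
- exact: Def_false.
- exact: Def_eq.
- exact: (Def_formula B (fRel t)).
- exact: Def_imp.
apply: (@Def_all B _ (fun x v => Z x -> holds Z p (vcons x v))).
apply: Def_imp => //.
apply: Def_ext (Def_ren (fun i => unlift ord0 i) IH) => u.
by apply: eq_iff; congr holds; apply/funext => i; rewrite /vcons; case: unlift.
Qed.

(** * Definable sets of elements; completeness and elementarity as one closure property *)

Definition DefOver B : set (set C) :=
  fun X => Def B (fun v : unit -> C => X (v tt)).

Lemma DefOver_var B X V (a : V) : DefOver B X -> Def B (fun v => X (v a)).
Proof. exact: (@Def_ren _ _ _ (fun=> a)). Qed.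

Lemma DefOver_and B X Y : DefOver B X -> DefOver B Y -> DefOver B (X `&` Y).
Proof. exact: Def_and. Qed.

Lemma DefOverT B : DefOver B setT. Proof. exact: Def_true. Qed.

Lemma DefOverP B : DefOver B P. Proof. exact: Def_P. Qed.

Lemma DefOver_eq B b : B b -> DefOver B [set b].
Proof.
move=> Bb.
apply: (Def_subst (fun x : bool => if x then inl tt else inr (SigSub (mem_set Bb)))
  (Def_eq B true false)).
Qed.

Lemma DefOver_neq B b : B b -> DefOver B (~` [set b]).
Proof. by move=> /DefOver_eq; apply: Def_not. Qed.

Lemma DefOver_pformula B X : DefOver B X <-> exists psi : pformula C 1,
  tuple_in B (params psi) /\ forall x, X x <-> pholds setT psi (fun=> x).
Proof.
split=> [[n [p [s h]]]|[[n p b] [/= Bb h]]]; last first.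
  apply: Def_ext (Def_subst (fun i : 'I_(1 + n) => match fintype.split i with
    | inl _ => inl tt | inr j => inr (SigSub (mem_set (Bb j))) end)
        (Def_formula B p)) => v.
  rewrite h /pholds /=; apply: eq_iff; congr holds; apply/funext => i.
  by rewrite /vcat; case: fintype.split.
(* The slots of the free variable need a filler among the parameters. An empty [B] has none, but
   then the formula contains no parameter either. *)
have [[b0 Bb0]|B0] := pselect (B !=set0); last first.
  have st i : s i = inl tt.
    case: (s i) => [[]|b] //; case: B0; exists (set_val b); exact: set_valP.
  exists (PFormula (k := 1) (nparam := 0) (ren p (fun=> ord0 : 'I_(1 + 0)))
    (fun i : 'I_0 => match notF (ltn_ord i) with end)); split; first by case.
  move=> x; rewrite (h (fun=> x)) /pholds /= holds_ren.
  apply: eq_iff; congr holds; apply/funext => i; rewrite st /=.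
  have -> : ord0 = lshift 0 (ord0 : 'I_1) :> 'I_(1 + 0) by exact: val_inj.
  by rewrite vcat_l.
pose f i : 'I_(1 + n) := if s i is inl _ then lshift n ord0 else rshift 1 i.
pose b i := if s i is inr b then set_val b else b0.
exists (PFormula (ren p f) b); split.
  by move=> i; rewrite /= /b; case: (s i) => // c; exact: set_valP.
move=> x; rewrite (h (fun=> x)) /pholds /= holds_ren.
apply: eq_iff; congr holds; apply/funext => i; rewrite /f /b.
by case E : (s i) => [[]|c]; rewrite ?vcat_l ?vcat_r ?E.
Qed.

(** One notion for two properties: with [Z = setT] it is the Tarski-Vaught criterion, with [Z = P]
    it is completeness of [A]. A single variable suffices by [closed_tuple]. *)
Definition closed Z A : Prop := forall X, DefOver A X ->
  (exists2 x, Z x & X x) -> exists x, [/\ Z x, A x & X x].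

(** Coordinates are found one at a time: the first satisfies an existential condition over [A], and
    once chosen in [A] it becomes a further parameter. *)
Lemma closed_tuple Z A k (D : ('I_k -> C) -> Prop) :
  (forall W (a : W), Def A (fun w => Z (w a))) ->
  closed Z A -> Def A D -> (exists a, tuple_in Z a /\ D a) ->
  exists a, tuple_in (Z `&` A) a /\ D a.
Proof.
move=> DZ clA; elim: k D => [|k IH] D DD [a [Za Da]].
  by exists a; split=> // -[].
have [||x0 [Zx Ax [a' [Za' Da']]]] :=
    clA (fun x => exists a' : 'I_k -> C, tuple_in Z a' /\ D (vcons x a')).
- apply: (@Def_ext_t A k unit (fun a' v => tuple_in Z a' /\ D (vcons (v tt) a'))).
  apply: Def_and; first exact: Def_tuple_in.
  apply: Def_ext (Def_ren (fun i => if unlift ord0 i is Some j then inl j else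
      inr tt) DD) => u.
  by apply: eq_iff; congr D; apply/funext => i; rewrite /vcons; case: unlift.
- exists (a ord0) => //; exists (fun i => a (lift ord0 i)).
  by split; [move=> i; apply: Za|rewrite -vcons_eta].
have [|/=|b [Zb Db]] := IH (fun a' => D (vcons x0 a')).
- apply: Def_ext (Def_subst (fun i => if unlift ord0 i is Some j then inl j
    else inr (SigSub (mem_set Ax))) DD) => u.
  by apply: eq_iff; congr D; apply/funext => i; rewrite /vcons; case: unlift.
- by exists a'.
exists (vcons x0 b); split=> // i.
by case: (unliftP ord0 i) => [j ->|->]; rewrite ?vcons0 ?vconsS.
Qed.

Lemma Def_params A k n (psi : formula L (k + n)) (b : 'I_n -> C) :
  tuple_in A b -> Def A (fun a => holds setT psi (vcat a b)).
Proof.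
move=> Ab; apply: Def_ext (Def_subst (fun i : 'I_(k + n) => match fintype.split i with
    | inl i => inl i | inr j => inr (SigSub (mem_set (Ab j))) end)
        (Def_formula A psi)) => v.
apply: eq_iff; congr holds; apply/funext => i.
by rewrite /vcat; case: fintype.split.
Qed.

Lemma complete_closed A : complete_set A <-> closed P A.
Proof.
split=> [cA X /DefOver_pformula[[n psi b] [/= Ab h]] [x Px Xx]|cA k n psi b Ab ex].
  have [|a [PAa ha]] := cA 1 n psi b Ab.
    by exists (fun=> x); split=> //; apply/h.
  have [Pa Aa] := PAa ord0; exists (a ord0); split=> //; apply/h.
  by move: ha; rewrite /pholds /=;
      have -> : a = (fun=> a ord0) by apply/funext => i; rewrite ord1.
apply: (closed_tuple (D := fun a => holds setT psi (vcat a b))) => //.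
- by move=> W a; exact: Def_P.
- exact: Def_params.
Qed.

Lemma vcat_vcons T n (x : T) (b : 'I_n -> T) : vcat (fun _ : 'I_1 => x) b = vcons x b.
Proof.
apply/funext => i; rewrite -[i](@splitK 1 n).
case: (fintype.split i) => j; rewrite /unsplit ?vcat_l ?vcat_r.
  have -> : lshift n j = ord0 by apply: val_inj; rewrite /= ord1.
  by rewrite vcons0.
have -> : rshift 1 j = lift ord0 j by exact: val_inj.
by rewrite vconsS.
Qed.

(** The Tarski-Vaught induction relative to [Z]. For [Z = P] it makes [P^A] elementary in [P]
    whenever [A] is complete. *)
Lemma closed_holds Z A n (phi : formula L n) v :
  (forall W (a : W), Def A (fun w => Z (w a))) -> closed Z A ->
  tuple_in (Z `&` A) v -> (holds (Z `&` A) phi v <-> holds Z phi v).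
Proof.
move=> DZ cA; elim: phi v => {n} [n|n i j|n r t|n p1 IH1 p2 IH2|n p IH] v Av //=.
  by rewrite IH1 // IH2.
have Avc x : (Z `&` A) x -> tuple_in (Z `&` A) (vcons x v).
  by move=> ZAx i; rewrite /vcons; case: unlift.
split=> h x Ax; last by apply/(IH _ (Avc _ Ax)); apply: h; case: Ax.
apply: contrapT => nh.
have [||y [Zy Ay]] := cA (fun x => ~ holds Z p (vcons x v)).
- apply: Def_not; have Av' i : v i \in A by apply: mem_set; case: (Av i).
  apply: Def_ext (Def_subst (fun i => if unlift ord0 i is Some j then
    inr (SigSub (Av' j)) else inl tt) (Def_relativized p DZ)) => u.
  apply: eq_iff; congr holds; apply/funext => i.
  by rewrite /vcons; case: unlift.
- by exists x.
by case; apply/(IH _ (Avc _ (conj Zy Ay))); apply: h.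
Qed.

Lemma elementary_closed A : elementary A [set: C] <-> closed setT A.
Proof.
split=> [[_ eA] X /DefOver_pformula[[n psi b] [/= Ab h]] [x _ Xx]|cA].
  have /existsNP[y /not_implyP[Ay hy]] : ~ holds A
      (fAll (fImp psi (fFalse L _)) : formula L n) b.
    by move/(eA _ _ _ Ab) => /(_ x I); apply; rewrite -vcat_vcons; apply/h.
  exists y; split=> //; apply/h; rewrite /pholds /= vcat_vcons.
  apply/eA; first by move=> i; rewrite /vcons; case: unlift.
  by apply: contrapT => k; exact: hy.
split=> // n phi v Av; rewrite -[A]setTI.
by apply: closed_holds; rewrite ?setTI // => W a; exact: Def_true.
Qed.

End Definability.

(** * Families of definable sets and saturation *)

Section Families.
Context (L : language) (C : structure L).
Implicit Types (A B Z X : set C) (F : set (set C)) (s : seq (set C)).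
Local Notation P := (P_of C).
Local Notation N := {n & formula L n}.

Definition inter s : set C := foldr setI setT s.

Definition fip Z F : Prop :=
  forall s, List.Forall F s -> exists2 x, Z x & inter s x.

Lemma inter_cat s t : inter (s ++ t) = inter s `&` inter t.
Proof. by elim: s => [|X s IH] /=; rewrite ?setTI // IH setIA. Qed.

Lemma inter_DefOver B s : List.Forall (DefOver B) s -> DefOver B (inter s).
Proof.
elim=> [|X s' DX _ IH]; [exact: DefOverT|exact: DefOver_and].
Qed.

Lemma Forall_setU1 F X s : List.Forall (F `|` [set X]) s ->
  exists2 t, List.Forall F t & inter t `&` X `<=` inter s.
Proof.
elim=> [|Y s' [FY|->] _ [t Ft ts]]; first by exists [::] => //; constructor.
  by exists (Y :: t); [constructor|move=> x [[Yx tx] Xx]; split=> //; apply: ts].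
by exists t => // x [tx Xx]; split=> //; apply: ts.
Qed.

Lemma finite_set_list T (A : set T) : finite_set A ->
  exists s : seq T, List.Forall A s /\ forall x, A x -> List.In x s.
Proof.
elim/Peq: T => T in A * => /finite_seqP[s ->]; exists s.
elim: s => [|x s [IH1 IH2]]; first by split; [constructor|].
split; first constructor; rewrite /= ?inE ?eqxx //.
  apply: List.Forall_impl IH1 => y; rewrite /= inE => ->; exact: orbT.
by move=> y; rewrite /= inE => /orP[/eqP ->|/IH2]; [left|right].
Qed.

Lemma list_finite_set T (s : seq T) : finite_set [set x | List.In x s].
Proof.
elim: s => [|x s IH]; first by rewrite (_ : [set _ | _] = set0) // -subset0.
rewrite (_ : [set _ | _] = [set x] `|` [set y | List.In y s]).
  by rewrite finite_setU; split.
by apply/seteqP; split=> y /= [->|]; [left|right|left|right].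
Qed.

(** Members of [F] have only to agree on [A] with formulas evaluated inside [A]; this is what
    [stable_transfer] can supply when the substructure is [P^A]. *)
Lemma saturated_fip U (K : set U) A B F :
  card_saturated K A -> B `<=` A -> card_lt B K ->
  (forall X, F X -> exists psi : pformula C 1, tuple_in B (params psi) /\
    forall x, A x -> (X x <-> pholds A psi (fun=> x))) ->
  fip A F -> exists2 x, A x & forall X, F X -> X x.
Proof.
move=> sA BA BK FP Ffip.
pose p := [set psi : pformula C 1 | tuple_in B (params psi) /\
  exists2 X, F X & forall x, A x -> (X x <-> pholds A psi (fun=> x))].
have const (a : 'I_1 -> C) : (fun=> a ord0) = a.
  by apply/funext => i; rewrite ord1.
have [||a [Aa ha]] := sA B BA BK p; first by move=> psi [].
- move=> p0 p0p /finite_set_list[s [sp0 p0s]].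
  have [t Ft ts] : exists2 t, List.Forall F t &
      forall x, A x -> inter t x -> forall psi, List.In psi s -> pholds A psi (fun=> x).
    elim: sp0 {p0s} => [|psi s' /p0p[_ [X FX Xpsi]] _ [t Ft ts]].
      by exists [::]; first constructor.
    exists (X :: t); first by constructor.
    by move=> x Ax [Xx tx] phi [<-|/ts]; [apply/Xpsi|apply].
  have [x Ax tx] := Ffip t Ft; exists (fun=> x); split=> // psi /p0s.
  exact: ts.
exists (a ord0); first exact: Aa.
move=> X FX; have [psi [Bpsi Xpsi]] := FP X FX.
by apply/Xpsi => //; rewrite const; apply: ha; split=> //; exists X.
Qed.

(** Types are evaluated in the substructure on the intersection of [Z] and [A]; closedness replaces
    this by truth in [Z], which is definable in [C]. Adding [Z] itself to the family keeps the
    realization inside [Z]. *)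
Lemma saturated_of_fip U (K : set U) Z A :
  (forall V (a : V), Def (@set0 C) (fun w => Z (w a))) -> closed Z A ->
  (forall B F, B `<=` A -> card_lt B K -> F `<=` DefOver B -> fip setT F ->
    exists2 x, A x & forall X, F X -> X x) ->
  card_saturated K (Z `&` A).
Proof.
move=> DZ0 cA sat B BA BK p pB pfin.
have DZ D V (a : V) : Def D (fun w => Z (w a)) by apply: Def_mono (DZ0 V a).
have BA' : B `<=` A by move=> x /BA[].
pose X (psi : pformula C 1) : set C := [set x | pholds Z psi (fun=> x)].
have const (a : 'I_1 -> C) : (fun=> a ord0) = a.
  by apply/funext => i; rewrite ord1.
have hZ (psi : pformula C 1) x : p psi -> (Z `&` A) x ->
    (pholds (Z `&` A) psi (fun=> x) <-> pholds Z psi (fun=> x)).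
  move=> /pB psiB ZAx; apply: closed_holds => // i.
  by rewrite /vcat; case: fintype.split => j //; apply/BA/psiB.
have [||x Ax hx] := sat B (Z |` [set X psi | psi in p]) BA' BK.
- move=> _ [->|[psi /pB Bpsi <-]]; first exact: (DZ B unit tt).
  case: psi Bpsi => n phi b /= Bb.
  apply: Def_ext (Def_subst (fun i : 'I_(1 + n) => match fintype.split i with
    | inl _ => inl tt | inr j => inr (SigSub (mem_set (Bb j))) end)
    (Def_relativized phi (DZ B))) => v.
  apply: eq_iff; congr holds; apply/funext => i.
  by rewrite /vcat; case: fintype.split.
- move=> s sX.
  have [t tp ts] : exists2 t, List.Forall p t & forall x, (Z `&` A) x ->
      (forall psi, List.In psi t -> pholds (Z `&` A) psi (fun=> x)) -> inter s x.
    elim: sX => [|Y s' [->|[psi ppsi <-]] _ [t tp ts]].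
    - by exists [::]; first constructor.
    - by exists t => // x ZAx h; split; [case: ZAx|apply: ts].
    exists (psi :: t); first by constructor.
    move=> x ZAx h; split; last by apply: ts => // phi tphi; apply: h; right.
    by apply/hZ => //; apply: h; left.
  have [||a [ZAa ha]] := pfin [set psi | List.In psi t].
  + by move=> psi /= tpsi; move/List.Forall_forall: tp; apply.
  + exact: list_finite_set.
  exists (a ord0) => //; apply: ts => // psi tpsi; rewrite const.
  exact: ha.
have ZAx : (Z `&` A) x by split=> //; apply: hx; left.
exists (fun=> x); split=> // psi ppsi; apply/hZ => //.
by apply: (hx (X psi)); right; exists psi.
Qed.

Lemma inj_formulas : tle nat N.
Proof. by exists (fun n => existT _ n (fFalse L n)) => m n /(congr1 (@projT1 _ _)). Qed.

Lemma DefOver_tle B : tle (DefOver B) (N * seq (unit + B)).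
Proof.
apply: (tle_cover (f := fun c : N * seq (unit + B) => [set x |
  holds setT (projT2 c.1) (fun i => env (fun _ : unit => x) (nth (inl tt) c.2 i))])).
move=> X [n [phi [s h]]].
exists (existT _ n phi, [seq s i | i <- enum 'I_n]); apply/seteqP.
have e x : (fun i : 'I_n =>
    env (fun _ : unit => x) (nth (inl tt) [seq s i | i <- enum 'I_n] i)) =
    (fun i => env (fun _ : unit => x) (s i)).
  by apply/funext => i; rewrite (nth_map i) ?size_enum_ord // nth_ord_enum.
by split=> x /=; rewrite e (h (fun=> x)).
Qed.

Lemma Def_definable k (D : ('I_k -> C) -> Prop) :
  Def set0 D -> definable setT set0 [set v | D v].
Proof.
move=> [n [phi [s h]]].
have s0 i : exists j, s i = inl j.
  by case: (s i) => [j|b]; [exists j|have := set_valP b].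
have [t tP] := choice s0.
exists 0, (ren phi (fun i => lshift 0 (t i))),
    (fun i : 'I_0 => match notF (ltn_ord i) with end).
split; first by case.
apply/seteqP; split=> v /=; rewrite h holds_ren.
  move=> k1; split=> //; move: k1; apply: iffLR; apply: eq_iff; congr holds.
  by apply/funext => i; rewrite tP vcat_l.
move=> [_]; apply: iffLR; apply: eq_iff; congr holds.
by apply/funext => i; rewrite tP vcat_l.
Qed.

(** Stable embeddedness yields parameters in [P], possibly outside [A]. That a tuple defines the
    trace of [X] on [P] is a condition over [A], so completeness finds such a tuple in [P^A]. The
    hypothesis on the induced structure then replaces truth in [C] by truth in [P], and completeness
    replaces that by truth in [P^A]. *)
Lemma stable_transfer A X :
  P_stably_embedded C -> P_induced_structure C -> closed P A -> DefOver A X ->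
  exists psi : pformula C 1, tuple_in (P `&` A) (params psi) /\
    forall x, (P `&` A) x -> (X x <-> pholds (P `&` A) psi (fun=> x)).
Proof.
move=> Cst Cind cA DX.
have const (a : 'I_1 -> C) : (fun=> a ord0) = a.
  by apply/funext => i; rewrite ord1.
have [||n [phi [b [Pb hb]]]] := Cst 1 [set v | P (v ord0) /\ X (v ord0)].
- by move=> v [Pv _] i; rewrite ord1.
- have /DefOver_pformula[psi [_ hpsi]] : DefOver A (P `&` X).
    by apply: DefOver_and => //; exact: DefOverP.
  exists (nparam psi), (pf_formula psi), (params psi); split=> //.
  apply/seteqP; split=> v /= => [h|[_ h]].
    by split=> //; have /hpsi := h : (P `&` X) (v ord0); rewrite /pholds const.
  by apply/hpsi; rewrite /pholds const.
have {}hb x : P x /\ X x <-> holds setT phi (vcat (fun _ : 'I_1 => x) b).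
  have e : [set v : 'I_1 -> C | P (v ord0) /\ X (v ord0)] (fun=> x) =
    [set v | tuple_in setT v /\ holds setT phi (vcat v b)] (fun=> x) by rewrite hb.
  by move: e => /= e; split=> [|h]; [rewrite e => -[]|rewrite e].
have PW V (a : V) : Def A (fun w => P (w a)) by exact: Def_P.
have [||b' [PAb' hb']] := closed_tuple (D := fun b : 'I_n -> C => forall x,
    (P x /\ X x) <-> holds setT phi (vcat (fun _ : 'I_1 => x) b)) PW cA.
- apply: (Def_all (F :=
      fun x (b : 'I_n -> C) => (P x /\ X x) <->
          holds setT phi (vcat (fun _ : 'I_1 => x) b))).
  apply: Def_iff; first by apply: Def_and; [exact: Def_P|exact: DefOver_var].
  apply: Def_ext (Def_ren (fun i : 'I_(1 + n) => match fintype.split i with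
    | inl _ => None | inr j => Some j end) (Def_formula A phi)) => v.
  apply: eq_iff; congr holds; apply/funext => i.
  by rewrite /vcat; case: fintype.split.
- by exists b.
have [||n0 [chi [b0 [b00 hR]]]] :=
    Cind (1 + n) [set v | tuple_in P v /\ holds setT phi v].
- by move=> v [].
- apply: (Def_definable (D := fun v => tuple_in P v /\ holds setT phi v)).
  apply: Def_and; last exact: Def_formula.
  by apply: (Def_tuple_in id) => V a; exact: Def_P.
(* [b0] is a tuple from the empty set, so its slots do not exist and [g] merely drops them. *)
pose g (i : 'I_((1 + n) + n0)) : 'I_(1 + n) := match fintype.split i with
  | inl i => i | inr j => match b00 j with end end.
exists (PFormula (ren chi g) b'); split=> // x [Px Ax].
rewrite /pholds /= holds_ren; set v := vcat _ _.
have vP : tuple_in (P `&` A) v.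
  by rewrite /v => i; rewrite /vcat; case: fintype.split.
have -> : (fun i => v (g i)) = vcat v b0.
  by apply/funext => i; rewrite /g /vcat; case: fintype.split => // j; case: (b00 j).
rewrite closed_holds //; last first.
  by move=> i; rewrite /vcat; case: fintype.split => [//|j]; case: (b00 j).
have -> : X x <-> holds setT phi v by rewrite -hb'; tauto.
have e : [set v | tuple_in P v /\ holds setT phi v] v =
  [set v | tuple_in P v /\ holds P chi (vcat v b0)] v by rewrite hR.
move: e => /= e; have vP' : tuple_in P v by move=> i; case: (vP i).
split=> h; first by have [] : tuple_in P v /\ holds P chi (vcat v b0) by rewrite -e.
by have [] : tuple_in P v /\ holds setT phi v by rewrite e.
Qed.

End Families.

(** * The game *)

Section Game.
Context (L : language) (C : structure L).
Implicit Types (A B Z X Y : set C) (F : set (set C)) (s : seq (set C)).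
Local Notation P := (P_of C).
Local Notation N := {n & formula L n}.

(** Variable 0 is the requested [y] in [P], variable 1 the element [x] under construction, and the
    other [m] variables are parameters. *)
Definition challenge := {m & formula L m.+2}.

Definition answer (t : challenge) (a : 'I_(projT1 t) -> C) (y : C) : set C :=
  [set x | holds setT (projT2 t) (vcons y (vcons x a))].

Definition refusal (t : challenge) (a : 'I_(projT1 t) -> C) : set C :=
  [set x | ~ exists2 y, P y & answer a y x].

(* One player tries to keep X nonempty while the other one issues the demands
   listed in G, choosing their parameters: [None] asks to leave out an element
   of C, [Some t] to leave out every x with a solution of t in P, or else to
   commit to a solution y that works for all x kept. *)
Fixpoint wins (G : seq (option challenge)) X : Prop :=
  match G with
  | [::] => X !=set0
  | None :: G' => forall a, wins G' (X `&` ~` [set a])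
  | Some t :: G' => forall a : 'I_(projT1 t) -> C,
      wins G' (X `&` refusal a) \/ exists2 y, P y & wins G' (X `&` answer a y)
  end.

Lemma wins_sub G X Y : X `<=` Y -> wins G X -> wins G Y.
Proof.
elim: G X Y => [|[t|] G IH] X Y XY /=.
- by move=> [x Xx]; exists x; apply: XY.
- move=> h a; have [k|[y Py k]] := h a; [left|right; exists y => //];
      apply: IH k; exact: setSI.
- by move=> h a; apply: IH (h a); apply: setSI.
Qed.

Lemma wins_behead m G X : wins (m :: G) X -> wins G X.
Proof.
have [c] := carrier_inhabited C.
case: m => [t|] /=; last by move=> /(_ c); apply: wins_sub => x [].
by move=> /(_ (fun=> c)) [|[y _]]; apply: wins_sub => x [].
Qed.

Lemma wins_catr G G' X : wins (G ++ G') X -> wins G' X.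
Proof. by elim: G => //= m G IH /wins_behead. Qed.

Lemma wins_nonempty G X : wins G X -> X !=set0.
Proof. by elim: G => //= m G IH /wins_behead. Qed.

Lemma wins_catl G G' X : wins (G ++ G') X -> wins G X.
Proof.
elim: G X => [|[t|] G IH] X /=; first exact: wins_nonempty.
  by move=> h a; have [k|[y Py k]] := h a; [left|right; exists y => //]; apply: IH.
by move=> h a; apply: IH.
Qed.

(** Any fixed [x] in [X] dictates a winning play as long as no demand can exclude it. Hence
    consistency is all that is asked of a type when non-algebraicity is dropped. *)
Lemma wins_pos G X : all isSome G -> X !=set0 -> wins G X.
Proof.
elim: G X => [//|[t|//] G IH] X /= aG [x Xx] a.
have [[y Py yx]|no] := pselect (exists2 y, P y & answer a y x).
  by right; exists y => //; apply: IH => //; exists x.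
by left; apply: IH => //; exists x.
Qed.

Lemma Def_answer B (t : challenge) :
  Def B (fun v : 'I_(projT1 t) + bool -> C =>
      answer (fun i => v (inl i)) (v (inr true)) (v (inr false))).
Proof.
apply: Def_ext (Def_ren (fun i => if unlift ord0 i is Some j then
  (if unlift ord0 j is Some k then inl k else inr false) else inr true)
      (Def_formula B (projT2 t))) => v.
apply: eq_iff; congr holds; apply/funext => i.
by rewrite {1}/vcons; case: unlift => // j; rewrite {1}/vcons; case: unlift.
Qed.

Lemma Def_answer_var B V (t : challenge) (fa : 'I_(projT1 t) -> V) (y x : V) :
  Def B (fun v : V -> C => answer (fun i => v (fa i)) (v y) (v x)).
Proof.
exact: (Def_ren (fun c => match c with inl i => fa i | inr b =>
    if b then y else x end) (Def_answer B t)).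
Qed.

Lemma Def_refusal_var B V (t : challenge) (fa : 'I_(projT1 t) -> V) (x : V) :
  Def B (fun v : V -> C => refusal (fun i => v (fa i)) (v x)).
Proof.
apply: Def_not; apply: (Def_ext (D :=
    fun v => exists y, P y /\ answer (fun i => v (fa i)) y (v x))).
  by move=> v; split=> [[y []]|[y]]; exists y.
apply: (Def_ex (F := fun y v => P y /\ answer (fun i => v (fa i)) y (v x))).
apply: Def_and; first exact: Def_P.
exact: (Def_answer_var B (fun i => Some (fa i)) None (Some x)).
Qed.

Definition response G X (t : challenge) (a : 'I_(projT1 t) -> C) : Prop :=
  wins G (X `&` refusal a) \/ exists2 y, P y & wins G (X `&` answer a y).

(** Definability of the rest of the game is a hypothesis, so that the lemma serves both inside the
    induction for [Def_wins] and after it. *)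
Lemma Def_response B G (t : challenge) V (X : (V -> C) -> set C) :
  (forall W (X : (W -> C) -> set C),
     Def B (fun u : option W -> C => X (fun a => u (Some a)) (u None)) ->
     Def B (fun w => wins G (X w))) ->
  Def B (fun u : option V -> C => X (fun a => u (Some a)) (u None)) ->
  Def B (fun u : 'I_(projT1 t) + V -> C =>
    response G (X (fun a => u (inr a))) (fun i => u (inl i))).
Proof.
set n := projT1 t => IH DX.
have DX' : Def B (fun u : option ('I_n + V) -> C =>
    X (fun a => u (Some (inr a))) (u None)).
  exact: (Def_ren (fun o => if o is Some a then Some (inr a) else None) DX).
have DX'' : Def B (fun u : option (option ('I_n + V)) -> C =>
    X (fun a => u (Some (Some (inr a)))) (u None)).
  exact: (Def_ren (fun o => if o is Some a then Some (Some (inr a)) else None) DX).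
apply: Def_or.
  apply: (IH _ (fun u : 'I_n + V -> C =>
      X (fun a => u (inr a)) `&` refusal (fun i => u (inl i)))).
  apply: Def_and => //; exact: (Def_refusal_var B (fun i => Some (inl i)) None).
apply: (Def_ext (D :=
    fun u : 'I_n + V -> C => exists y, P y /\
        wins G (X (fun a => u (inr a)) `&` answer (fun i => u (inl i)) y))).
  by move=> v; split=> [[y []]|[y]]; exists y.
apply: (Def_ex (F := fun y (u : 'I_n + V -> C) => P y /\
    wins G (X (fun a => u (inr a)) `&` answer (fun i => u (inl i)) y))).
apply: Def_and; first exact: Def_P.
apply: (IH _ (fun u : option ('I_n + V) -> C =>
    X (fun a => u (Some (inr a))) `&` answer (fun i => u (Some (inl i))) (u None))).
apply: Def_and => //.
exact: (Def_answer_var B (fun i => Some (Some (inl i))) (Some None) None).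
Qed.

(** The position must vary with [w], because each round cuts it down by a set whose parameters are
    quantified. *)
Lemma Def_wins B G V (X : (V -> C) -> set C) :
  Def B (fun u : option V -> C => X (fun a => u (Some a)) (u None)) ->
  Def B (fun w => wins G (X w)).
Proof.
elim: G V X => [|[t|] G IH] V X DX /=.
- exact: (Def_ex (F := fun x w => X w x)).
- apply: (@Def_allt _ _ B (projT1 t) V (fun a w => response G (X w) a)).
  exact: Def_response.
- apply: (Def_all (F := fun a w => wins G (X w `&` ~` [set a]))).
  apply: (IH _ (fun u : option V -> C => X (fun a => u (Some a)) `&` ~` [set u None])).
  apply: Def_and.
    exact: (Def_ren (fun o => if o is Some a then Some (Some a) else None) DX).
  apply: Def_not; exact: (Def_eq B None (Some None)).
Qed.

Lemma DefOver_answer A t (a : 'I_(projT1 t) -> C) y :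
  tuple_in A a -> A y -> DefOver A (answer a y).
Proof.
move=> Aa Ay.
exact: (Def_subst (fun c : 'I_(projT1 t) + bool => match c with
  | inl i => inr (SigSub (mem_set (Aa i)))
  | inr b => if b then inr (SigSub (mem_set Ay)) else inl tt end) (Def_answer A t)).
Qed.

Lemma DefOver_refusal A t (a : 'I_(projT1 t) -> C) :
  tuple_in A a -> DefOver A (refusal a).
Proof.
move=> Aa.
exact: (Def_subst (fun c : 'I_(projT1 t) + unit => match c with
  | inl i => inr (SigSub (mem_set (Aa i))) | inr b => inl tt end)
  (Def_refusal_var A inl (inr tt))).
Qed.

(** This condition packs completeness of [A] with [c] added and the absence of new elements of [P].
    In [D], [true] stands for the element of [P] and [false] for [c]. *)
Definition P_tight A c : Prop := forall D : (bool -> C) -> Prop, Def A D ->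
  (exists2 y, P y & D (fun b => if b then y else c)) ->
  exists y, [/\ P y, A y & D (fun b => if b then y else c)].

Lemma P_tightP A c : P_tight A c <-> closed P (A `|` [set c]) /\ (P c -> A c).
Proof.
split=> [h|[h Pc]].
  split; last first.
    (* Applied to the condition [y = c], tightness puts [c] into [A]. *)
    move=> Pc; have [||y [Py Ay e]] := h (fun v => v true = v false).
    - exact: Def_eq.
    - by exists c.
    - by rewrite /= in e; rewrite -e.
  move=> X [n [phi [s hs]]] [y Py Xy].
  pose s' i : bool + A := match s i with
    | inl _ => inl true
    | inr b => match pselect (A (set_val b)) with
      | left Ab => inr (SigSub (mem_set Ab)) | right _ => inl false end end.
  have e z : (fun i => env (fun b : bool => if b then z else c) (s' i)) =
      (fun i => env (fun _ : unit => z) (s i)).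
    apply/funext => i; rewrite /s'; case: (s i) => // b /=.
    case: pselect => //= nAb; have [/nAb//|e] := set_valP b.
    exact: esym.
  have [||z [Pz Az hz]] := h (fun v => holds setT phi (fun i => env v (s' i))).
  - by exists n, phi, s'.
  - by exists y => //; rewrite e; apply/(hs (fun=> y)).
  - exists z; split=> //; first by left.
    by apply/(hs (fun=> z)); rewrite -e.
move=> D DD [y Py Dy].
have [||z [Pz Az Dz]] := h (fun z => D (fun b => if b then z else c)).
- have cA : (A `|` [set c]) c by right.
  apply: Def_ext (Def_subst (fun b : bool =>
      if b then inl tt else inr (SigSub (mem_set cA)))
    (Def_mono (B := A `|` [set c]) _ DD)) => [v|x Ax]; last by left.
  by apply: eq_iff; congr D; apply/funext => -[].
- by exists y.
exists z; split=> //.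
by case: Az => [//|/= zc]; rewrite zc in Pz *; apply: Pc.
Qed.

(** For parameters in [M] the player keeps [c]: a demand solvable at [c] has a solution in [M] by
    tightness, so the next position is again defined over [M]. If parameters in [C] defeated the
    player, some in [M] would, because winning is definable and [M] is elementary. *)
Lemma wins_witness M c X G : closed setT M -> ~ M c -> P_tight M c ->
  DefOver M X -> X c -> wins G X.
Proof.
move=> cM Mc tc; elim: G X => [|[t|] G IH] X DX Xc /=; first by exists c.
- move=> a; apply: contrapT => na.
  have [|||b [Mb nb]] := closed_tuple (k := projT1 t)
    (D := fun a : 'I_(projT1 t) -> C => ~ response G X a) (Z := setT) _ cM.
  - by move=> W w; exact: Def_true.
  - apply: Def_not.
    have DR := Def_response (V := False) (X := fun=> X) t
      (fun W f => @Def_wins M G W f) (DefOver_var None DX).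
    exact: (Def_ren (fun o : 'I_(projT1 t) + False => match o with
      | inl i => i | inr b => match b with end end) DR).
  - by exists a.
  apply: nb; rewrite setTI in Mb.
  have [ex|no] := pselect (exists2 y, P y & answer b y c); last first.
    left; apply: IH => //; apply: DefOver_and => //; exact: DefOver_refusal.
  have [||y [Py My yc]] := tc (fun v => answer b (v true) (v false)).
  - exact: (Def_subst (fun c : 'I_(projT1 t) + bool => match c with
      | inl i => inr (SigSub (mem_set (Mb i))) | inr b => inl b end) (Def_answer M t)).
  - exact: ex.
  right; exists y => //; apply: IH => //; apply: DefOver_and => //;
      exact: DefOver_answer.
- move=> a; apply: contrapT => na.
  have [||b [_ Mb nb]] := cM (fun a => ~ wins G (X `&` ~` [set a])).
  - apply: Def_not; apply: (Def_wins G (X := fun w : unit -> C => X `&` ~` [set w tt])).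
    apply: Def_and; first exact: DefOver_var.
    by apply: Def_not; exact: Def_eq.
  - by exists a.
  apply: nb; apply: IH; first by apply: DefOver_and => //; apply: DefOver_neq.
  by split=> // e; apply: Mc; rewrite e.
Qed.

End Game.

(** * Extending complete sets *)

Lemma tle_enum T U : tle T U -> exists e : U -> option T, forall t, exists u,
    e u = Some t.
Proof.
move=> [q qi].
have /choice[e eP] u : exists o : option T, forall t, q t = u -> o = Some t.
  have [[t <-]|no] := pselect (exists t, q t = u).
    by exists (Some t) => t' /qi ->.
  by exists None => t e; case: no; exists t.
by exists e => t; exists (q t); apply: eP.
Qed.

Lemma Forall_seq1 T (p : set T) x : p x -> List.Forall p [:: x].
Proof. by move=> px; constructor. Qed.

Section Build.
Context (L : language) (C : structure L) (Lam : Type) (R : Lam -> Lam -> Prop).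
Implicit Types (A B Z X Y : set C) (F : set (set C)) (s : seq (set C)).
Local Notation P := (P_of C).
Local Notation N := {n & formula L n}.
Hypotheses (sN : small Lam N)
  (Lam_pow : forall mu : set Lam, small Lam mu -> tle (mu -> Lam) Lam)
  (Rwo : strict_well_order R) (Rinit : forall i, small Lam [set j | R j i])
  (C_real : forall A F, tle A Lam -> F `<=` @DefOver L C A -> fip setT F ->
     exists x, forall X, F X -> X x).

(** Saturation of [P^A] against conditions whose parameters come from all of [A]. *)
Definition P_sat A : Prop := forall F, small Lam F -> F `<=` DefOver A -> fip P F ->
  exists y, [/\ P y, A y & forall X, F X -> X y].

(** [stable_transfer] moves each condition to finitely many parameters in [P^A], so a small family
    uses a small set of them. Completeness moves the finite intersection property from [P] to
    [P^A]. *)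
Lemma P_sat_saturated A : P_stably_embedded C -> P_induced_structure C ->
  closed P A -> P `&` A #= [set: Lam] -> saturated (P `&` A) -> P_sat A.
Proof.
move=> Cst Cind cA PAL sPA F sF FA Ffip.
have st X : exists psi : pformula C 1, F X -> tuple_in (P `&` A) (params psi) /\
    forall x, (P `&` A) x -> (X x <-> pholds (P `&` A) psi (fun=> x)).
  have [FX|nFX] := pselect (F X); last first.
    by exists (PFormula (nparam :=
        0) (fFalse L _) (fun i : 'I_0 => match notF (ltn_ord i) with end)).
  by have [psi h] := stable_transfer Cst Cind cA (FA _ FX); exists psi.
have [f fP] := choice st.
pose B := \bigcup_(X in [set: F]) range (params (f (set_val X))).
have BPA : B `<=` P `&` A.
  by move=> _ [X _ [i _ <-]]; have [h _] := fP _ (set_valP X); apply: h.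
have sB : small Lam B.
  apply: (small_bigcup (inj_formulas L) sN sF) => X.
  have nI : tle 'I_(nparam (f (set_val X))) nat by exists val; apply: val_inj.
  by apply: tle_trans nI;
      apply: (tle_cover (f := params (f (set_val X)))) => x [i _ <-]; exists i.
have PAL2 := PAL; rewrite card_eq_le in PAL2; case/andP: PAL2 => PAL1 PAL2.
have [|||x [Px Ax] xF] := saturated_fip (F := F) sPA BPA.
- split; first exact: subset_card_le.
  move=> h; apply: sB; apply/card_leTP; exact: card_le_trans PAL2 h.
- move=> X FX; have [h1 h2] := fP X FX; exists (f X); split; last exact: h2.
  by move=> i; exists (SigSub (mem_set FX)) => //; exists i.
- move=> s Fs; have [x Px sx] := Ffip s Fs.
  have [||y [Py Ay sy]] := cA (inter s).
  + by apply: inter_DefOver; apply: List.Forall_impl Fs => X; apply: FA.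
  + by exists x.
  + by exists y.
by exists x; split.
Qed.

Lemma challenge_tle : tle (challenge L) N.
Proof.
apply: (@tle_trans _ (option (challenge L))); first by exists some => x y [].
apply: (tle_surj (f := fun p : N => match p with existT n phi =>
  match n return formula L n -> option (challenge L) with
  | m.+2 => fun phi => Some (existT _ m phi) | _ => fun _ => None end phi end)).
by move=> [[m phi]|]; [exists (existT _ m.+2 phi)|exists (existT _ 0 (fFalse L 0))].
Qed.

Let natL : tle nat Lam := natLam (inj_formulas L) sN.
Let NL : tle N Lam := small_leL sN.

(** The invariant [J] says that finitely many commitments still win every allowed game. With
    [nal = true] all demands are allowed and [c] avoids [A]; with [nal = false] only the demands
    about [P] are. *)
Lemma P_tight_realization A F0 (nal : bool) :
  closed P A -> tle A Lam -> P_sat A -> A !=set0 -> small Lam F0 ->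
  F0 `<=` DefOver A ->
  (forall s, List.Forall F0 s -> forall G, nal || all isSome G -> wins G (inter s)) ->
  exists c, [/\ forall X, F0 X -> X c, P_tight A c & nal -> ~ A c].
Proof.
move=> cA AL satA [a00 Aa00] sF0 F0A winF0.
pose a0 : A := SigSub (mem_set Aa00).
pose allowed G := nal || all (@isSome (challenge L)) G.
have allowed_cat G G' : allowed G -> allowed G' -> allowed (G ++ G').
  by rewrite /allowed all_cat => /orP[->//|->] /orP[->//|->]; rewrite orbT.
pose J s := List.Forall (DefOver A) s /\ forall G, allowed G -> wins G (inter s).
have [e eP] : exists e : Lam -> option (challenge L * seq A + A), forall t,
    exists i, e i = Some t.
  apply: tle_enum; apply: tle_sum_inf => //; apply: tle_prod_inf => //;
      last exact: tle_seq_inf.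
  exact: tle_trans challenge_tle NL.
(* A finite list names the parameters; [a0] pads a list that is too short. *)
pose par (t : challenge L) (l : seq A) (i : 'I_(projT1 t)) : C := set_val (nth a0 l i).
have parA t l : tuple_in A (par t l) by move=> i; exact: set_valP.
pose Req i (v : set C) := match e i with
  | None => v = setT
  | Some (inl tl) => v = refusal (par tl.1 tl.2) \/
      exists y, [/\ P y, A y & v = answer (par tl.1 tl.2) y]
  | Some (inr a) => v = if nal then ~` [set set_val a] else setT
  end.
have [|s F0s|p [F0p Jp _ pReq]] := Lam_construction (inj_formulas L) sN Rwo Rinit
    (J := J) (Req := Req) _ sF0.
- move=> p i sp Jp.
  have pA : p `<=` DefOver A.
    move=> X pX; have [h _] := Jp [:: X] (Forall_seq1 pX).
    exact: List.Forall_inv h.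
  have JU (v : set C) : DefOver A v -> (forall s, List.Forall p s -> forall G,
      allowed G ->
      wins G (inter s `&` v)) -> forall s, List.Forall (p `|` [set v]) s -> J s.
    move=> DX h s ps; split.
      by apply: List.Forall_impl ps => X [/pA|->].
    move=> G aG; have [s' ps' s's] := Forall_setU1 ps.
    by apply: wins_sub s's _; apply: h.
  have JT : forall s, List.Forall (p `|` [set setT]) s -> J s.
    apply: JU => [|s ps G aG]; first exact: DefOverT.
    by rewrite setIT; apply: (Jp s ps).2.
  rewrite /Req; case: (e i) => [[[t l]|a]|]; last by exists setT.
    have [yes|no] := pselect (forall s,
        List.Forall (p `|` [set refusal (par t l)]) s -> J s).
      by exists (refusal (par t l)); split=> //; left.
    (* If refusing breaks the invariant, one list [s1] and one game [G1] show it; together they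
       exclude the refusal branch of any game that goes on to include [G1]. *)
    have [s1 [ps1 [G1 [aG1 nG1]]]] : exists s1, List.Forall p s1 /\
        exists G1, allowed G1 /\ ~ wins G1 (inter s1 `&` refusal (par t l)).
      apply: contrapT => h; apply: no; apply: JU; first exact: DefOver_refusal.
      move=> s ps G aG; apply: contrapT => nw; apply: h; exists s; split=> //;
          by exists G.
    (* The [y] whose commitment is harmless for one list and one game; a point common to all [H]
       preserves the invariant. *)
    pose H (sG : seq p * seq (option (challenge L))) : set C :=
      [set y | wins sG.2 (inter (map set_val sG.1) `&` answer (par t l) y)].
    pose HH := [set H sG | sG in [set sG | allowed sG.2]].
    have mapp (sq : seq p) : List.Forall p (map set_val sq).
      by elim: sq => [|x s IH]; constructor => //; exact: set_valP.
    have unmap s : List.Forall p s -> exists sp : seq p, map set_val sp = s.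
      elim=> [|X s' pX _ [sq <-]]; first by exists [::].
      by exists (SigSub (mem_set pX) :: sq).
    have [|||y [Py Ay hy]] := satA HH.
    + apply: small_le (small_prod (inj_formulas L) sN
        (small_seq (inj_formulas L) sN sp) (small_seq (inj_formulas L) sN
        (small_option (inj_formulas L) sN (small_le challenge_tle sN)))).
      by apply: (tle_cover (f := H)) => _ [sG _ <-]; exists sG.
    + move=> _ [[s G] /= aG <-].
      apply: (Def_wins G (X :=
          fun w : unit -> C => inter (map set_val s) `&` answer (par t l) (w tt))).
      apply: Def_and.
        have Ds : DefOver A (inter (map set_val s)).
          by apply: inter_DefOver; apply: List.Forall_impl (mapp s).
        exact: (DefOver_var None Ds).
      apply: Def_ext (Def_subst (fun c : 'I_(projT1 t) + bool => match c with
        | inl i => inr (SigSub (mem_set (parA t l i)))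
        | inr b => if b then inl (Some tt) else inl None end) (Def_answer A t)) => v.
      by [].
    + move=> r Hr.
      (* Finitely many conditions [H] follow from a single one, by concatenating the lists and the
         games. *)
      have [s [G [ps aG sr]]] : exists s G, [/\ List.Forall p s, allowed G &
          forall y, wins G (inter s `&` answer (par t l) y) -> inter r y].
        elim: Hr => [|_ r' [[s G] /= aG <-] _ [s' [G' [ps' aG' h]]]].
          by exists [::], [::]; split; [constructor|rewrite /allowed orbT|].
        exists (map set_val s ++ s'), (G ++ G'); split.
        - by apply/List.Forall_app; split => //; exact: mapp.
        - exact: allowed_cat.
        move=> y; rewrite inter_cat => w; split.
          by apply: wins_sub (wins_catl w); apply: setSI => x [].
        by apply: h; apply: wins_sub (wins_catr w); apply: setSI => x [].
      (* The demand [t] is played first, so that one solution must serve the whole of [G]. The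
         refusal branch would win [G1], which is excluded. *)
      have /(Jp _)[_ /(_ (Some t :: (G ++ G1)))] : List.Forall p (s ++ s1).
        by apply/List.Forall_app.
      have -> : allowed (Some t :: (G ++ G1)).
        exact: allowed_cat.
      move=> /(_ isT) /(_ (par t l))[w|[y Py w]].
        case: nG1; apply: wins_sub (wins_catr w); apply: setSI.
        by rewrite inter_cat => x [].
      exists y => //; apply: sr; apply: wins_sub (wins_catl w); apply: setSI.
      by rewrite inter_cat => x [].
    exists (answer (par t l) y); split; first by right; exists y.
    apply: JU; first exact: DefOver_answer.
    move=> s /unmap[sp' <-] G aG.
    by apply: (hy (H (sp', G))); exists (sp', G).
  case nalE: nal; last by exists setT.
  exists (~` [set set_val a]); split=> //; apply: JU.
    by apply: DefOver_neq; exact: set_valP.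
  move=> s ps G aG; have [_ /(_ (None :: G))] := Jp s ps.
  by rewrite /allowed nalE => /(_ isT); apply.
- split; last by move=> G aG; apply: winF0.
  by apply: List.Forall_impl F0s => X; apply: F0A.
have [|s ps|c cp] := C_real (F := p) AL.
- move=> X pX; have [h _] := Jp [:: X] (Forall_seq1 pX).
  exact: List.Forall_inv h.
- have [_ /(_ [::])[]] := Jp s ps; first by rewrite /allowed orbT.
  by move=> x sx; exists x.
exists c; split.
- by move=> X /F0p/cp.
- move=> D [n [phi [s h]]] [y Py Dy].
  (* The condition becomes a challenge: [y] and [c] go to variables 0 and 1, and parameter slots are
     shifted behind them. *)
  pose f i : 'I_n.+2 := match s i with
    | inl true => ord0 | inl false => lift ord0 ord0
    | inr _ => lift ord0 (lift ord0 i) end.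
  pose t : challenge L := existT _ n (ren phi f).
  pose l := [seq (if s i is inr b then b else a0) | i <- enum 'I_n].
  have DE z x : answer (par t l) z x <-> D (fun b => if b then z else x).
    rewrite /answer /= holds_ren h; apply: eq_iff; congr holds; apply/funext => i.
    rewrite /f; case E : (s i) => [[]|b]; rewrite ?vconsS ?vcons0 //.
    by rewrite /par /= (nth_map i) ?size_enum_ord // nth_ord_enum E.
  have [i ei] := eP (inl (t, l)); have [v pv] := pReq i.
  rewrite /Req ei => -[ve|[z [Pz Az ve]]].
    by have := cp _ pv; rewrite ve => -[]; exists y => //; apply/DE.
  by exists z; split=> //; apply/DE; have := cp _ pv; rewrite ve.
move=> nalT Ac; have [i ei] := eP (inr (SigSub (mem_set Ac))).
by have [v pv] := pReq i; rewrite /Req ei nalT => ve; have := cp _ pv;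
    rewrite ve; apply.
Qed.

End Build.

(** * Unions of chains, and closure under realization of small families *)

Lemma total_on_bigcup_finite T (S : set (set T)) n (Phi : 'I_n -> set T -> Prop) :
  S !=set0 -> total_on S subset ->
  (forall i X Y, X `<=` Y -> Phi i X -> Phi i Y) ->
  (forall i, exists2 X, S X & Phi i X) -> exists2 X, S X & forall i, Phi i X.
Proof.
move=> [X0 SX0] tot; elim: n Phi => [|n IH] Phi mon ex.
  by exists X0 => // -[].
have [|i|X SX hX] := IH (fun i => Phi (lift ord0 i)); first by move=> i; apply: mon.
  exact: ex.
have [Y SY hY] := ex ord0.
have [XY|YX] := tot X Y SX SY; [exists Y|exists X] => // i;
  case: (unliftP ord0 i) => [j ->|->] //; first exact: mon XY _.
exact: mon YX _.
Qed.

Section Closure.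
Context (L : language) (C : structure L) (Lam : Type) (R : Lam -> Lam -> Prop).
Implicit Types (A B Z X Y : set C) (F : set (set C)) (s : seq (set C)).
Local Notation P := (P_of C).
Local Notation N := {n & formula L n}.

Lemma DefOver_bigcup (S : set (set C)) X : S !=set0 -> total_on S subset ->
  DefOver (\bigcup_(B in S) B) X -> exists2 B, S B & DefOver B X.
Proof.
move=> S0 tot [n [phi [s h]]].
have [||B SB Bs] := total_on_bigcup_finite (Phi := fun (i : 'I_n) B =>
    forall b, s i = inr b -> B (set_val b)) S0 tot.
- by move=> i X1 X2 X12 h1 b /h1/X12.
- move=> i; case: (s i) => [u|b]; first by case: S0 => B SB; exists B.
  by have [B SB Bb] := set_valP b; exists B => // c [<-].
exists B => //; have [t tP] : exists t : 'I_n -> unit + B,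
    forall v i, env v (t i) = env v (s i).
  have /choice[t tP] i : exists y : unit + B, forall v, env v y = env v (s i).
    move: (Bs i); case: (s i) => [u|b] h1; first by exists (inl u).
    by exists (inr (SigSub (mem_set (h1 b erefl)))).
  by exists t => v i; exact: tP.
exists n, phi, t => v; rewrite h; apply: eq_iff; congr holds.
by apply/funext => i; rewrite tP.
Qed.

Lemma closed_bigcup (S : set (set C)) Z : S !=set0 -> total_on S subset ->
  (forall B, S B -> closed Z B) -> closed Z (\bigcup_(B in S) B).
Proof.
move=> S0 tot h X /(DefOver_bigcup S0 tot)[B SB DX] /(h _ SB _ DX)[x [Zx Bx Xx]].
by exists x; split=> //; exists B.
Qed.

Lemma DefOver_mono A B X : A `<=` B -> DefOver A X -> DefOver B X.
Proof. exact: Def_mono. Qed.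

Hypotheses (sN : small Lam N)
  (Lam_pow : forall mu : set Lam, small Lam mu -> tle (mu -> Lam) Lam)
  (Rwo : strict_well_order R) (Rinit : forall i, small Lam [set j | R j i]).

Let natL : tle nat Lam := natLam (inj_formulas L) sN.

(** Smallness is imposed on the family, not on its parameters; as there are fewer than [|Lam|]
    formulas, either one can be traded for the other. *)
Definition saturated_in A : Prop := forall F, small Lam F -> F `<=` @DefOver L C A ->
  fip setT F -> exists2 c, A c & forall X, F X -> X c.

(** The invariant [Q] is left open: it is trivial when a saturated model is built from nothing, and
    it fixes the [P]-part later. By regularity a small family over the result lives over some stage,
    and the bookkeeping returns to it after that stage. *)
Lemma saturation_closure (Q : set C -> Prop) A :
  (forall X F, Q X -> tle X Lam -> small Lam F -> F `<=` DefOver X -> fip setT F ->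
     exists2 c, (forall Y, F Y -> Y c) & Q (X `|` [set c])) ->
  (forall S : set (set C), S !=set0 -> S `<=` Q -> total_on S subset ->
     Q (\bigcup_(X in S) X)) ->
  Q A -> tle A Lam ->
  exists M, [/\ A `<=` M, Q M, tle M Lam & saturated_in M].
Proof.
move=> ext chain QA AL; have [wf tr tot] := Rwo.
have DefL X : tle X Lam -> tle (@DefOver L C X) Lam.
  move=> XL; apply: tle_trans (DefOver_tle X) _; apply: tle_prod_inf => //.
    exact: small_leL.
  apply: tle_seq_inf => //; apply: tle_sum_inf => //.
  exact: small_leL (small_fin (inj_formulas L) sN unit).
have /choice[h hP] X : exists e : Lam -> set (set C), tle X Lam ->
    forall F, small Lam F -> F `<=` DefOver X -> exists k, e k = F.
  have [XL|] := pselect (tle X Lam); last by exists (fun=> set0).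
  have [e eP] := small_subsets (inj_formulas L) sN Lam_pow Rwo Rinit (DefL X XL).
  exists (fun k => set_val @` (e k)) => _ F sF FX.
  have [|k ek] := eP [set D | F (set_val D)].
    apply: small_le sF; exists (fun D =>
        SigSub (mem_set (set_valP D : F (set_val (set_val D))))).
    by move=> D D' [/val_inj/val_inj].
  exists k; rewrite ek; apply/seteqP; split=> [_ [D FD <-] //|Y FY].
  by exists (SigSub (mem_set (FX _ FY))).
have [p pP] := bookkeeping (inj_formulas L) sN Rwo Rinit.
have l0 : Lam by have [e _] := cid natL; exact: e 0.
have [c0] := carrier_inhabited C.
pose st (d : Lam -> C) i := A `|` [set d j | j in [set j | R j i]].
(* Index [i] treats family number [(p i).2] over stage [(p i).1], provided that this stage is
   earlier; thus [fam d i] depends on earlier values only. *)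
pose fam d i := if pselect (R (p i).1 i) then h (st d (p i).1) (p i).2 else set0.
pose Phi i d v := (small Lam (fam d i) -> fam d i `<=` DefOver (st d i) ->
  fip setT (fam d i) -> forall Y, fam d i Y -> Y v) /\ Q (st d i `|` [set v]).
have stE i f g : (forall j, R j i -> f j = g j) -> st f i = st g i.
  by move=> fg; congr (_ `|` _); apply/seteqP; split=> _ [j ji <-];
      exists j => //; rewrite fg.
have [|d dP] := wf_choice (R := R) c0 (Phi := Phi) wf.
  move=> i f g fg; have sti := stE i f g fg.
  have fami : fam f i = fam g i.
    rewrite /fam; case: pselect => // ji; congr h; apply: stE => j jp.
    by apply: fg; apply: tr ji.
  by apply/funext => v; rewrite /Phi sti fami.
have stL i : tle (st d i) Lam.
  apply: tle_trans (_ : tle (A + Lam) Lam); last first.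
    by apply: tle_sum_inf => //; exact: tle_refl.
  apply: (tle_cover (f := fun x => match x with inl a => set_val a | inr j => d j end)).
  by move=> x [Ax|[j _ <-]]; [exists (inl (SigSub (mem_set Ax)))|exists (inr j)].
have Qunion (D : set Lam) : (forall i j, D j -> R i j -> D i) ->
    (forall j, D j -> Q (st d j `|` [set d j])) -> Q (A `|` [set d j | j in D]).
  move=> Ddown Dgood.
  pose S := A |` [set st d j `|` [set d j] | j in D].
  have -> : A `|` [set d j | j in D] = \bigcup_(X in S) X.
    apply/seteqP; split=> [x [Ax|[j Dj <-]]|x [_ [->|[j Dj <-]]]].
    - by exists A => //; left.
    - by exists (st d j `|` [set d j]); [right; exists j|right].
    - by left.
    - by move=> [[Ax|[i ij <-]]|->];
          [left|right; exists i => //; apply: Ddown ij|right; exists j].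
  have Ast j : A `<=` st d j `|` [set d j] by move=> x Ax; left; left.
  have mono i j : R i j -> st d i `|` [set d i] `<=` st d j `|` [set d j].
    move=> ij x [[Ax|[k ki <-]]|->]; left; [left|right|right] => //.
      by exists k => //; apply: tr ij.
    by exists i.
  apply: chain; first by exists A; left.
  - by move=> X [->|[j Dj <-]] //; apply: Dgood.
  - move=> X Y [->|[i Di <-]] [->|[j Dj <-]];
        try by [left|right|left; apply: Ast|right; apply: Ast].
    have [ij|->|ji] := tot i j; [left|left|right] => //; exact: mono.
have good : forall i, Phi i d (d i).
  apply: (well_founded_ind wf) => i IH; apply: dP.
  have Qi : Q (st d i).
    apply: Qunion => [a b bi ab|j ji]; first exact: tr ab bi.
    exact: (IH j ji).2.
  have [[sF [FD Ff]]|no] :=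
      pselect (small Lam (fam d i) /\ fam d i `<=` DefOver (st d i) /\
          fip setT (fam d i)).
    by have [c cF Qc] := ext _ _ Qi (stL i) sF FD Ff; exists c.
  (* With nothing to realize, an element preserving [Q] is still needed; the empty family yields
     one. *)
  have [|//||c _ Qc] := ext _ set0 Qi (stL i).
  - apply: small_le (small_fin (inj_formulas L) sN bool).
    by exists (fun=> true) => x; have := set_valP x.
  - by move=> s; case=> [|X s' []]; exists c0.
  by exists c; split=> // sF FD Ff; case: no.
exists (A `|` range d); split.
- by move=> x; left.
- by apply: Qunion => // j _; exact: (good j).2.
- apply: tle_trans (_ : tle (A + Lam) Lam); last first.
    by apply: tle_sum_inf => //; exact: tle_refl.
  apply: (tle_cover (f := fun x => match x with inl a => set_val a | inr j => d j end)).
  by move=> x [Ax|[j _ <-]]; [exists (inl (SigSub (mem_set Ax)))|exists (inr j)].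
move=> F sF FM Ff.
have ub (i : Lam) : exists j, R i j.
  have [j jP] := Lam_regular (inj_formulas L) sN Lam_pow Rwo Rinit (fun=> i)
    (small_fin (inj_formulas L) sN unit).
  by exists j; exact: jP tt.
pose S := [set st d j | j in [set: Lam]].
have stmono i j : R i j -> st d i `<=` st d j.
  by move=> ij x [Ax|[k ki <-]]; [left|right; exists k => //; apply: tr ij].
have Stot : total_on S subset.
  move=> _ _ [i _ <-] [j _ <-].
  have [ij|->|ji] := tot i j; [left|left|right] => //; exact: stmono.
have ME : A `|` range d = \bigcup_(X in S) X.
  apply/seteqP; split=> [x [Ax|[j _ <-]]|x [_ [j _ <-] [Ax|[i _ <-]]]].
  - by exists (st d l0); [exists l0|left].
  - by have [k jk] := ub j; exists (st d k); [exists k|right; exists j].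
  - by left.
  - by right; exists i.
have /choice[ix ixP] (Y : F) : exists i, DefOver (st d i) (set_val Y).
  have := FM _ (set_valP Y); rewrite ME => /DefOver_bigcup[||_ [i _ <-] ?] //.
    by exists (st d l0), l0.
  by exists i.
have [j jP] := Lam_regular (inj_formulas L) sN Lam_pow Rwo Rinit ix sF.
have FDj : F `<=` DefOver (st d j).
  move=> Y FY; have := ixP (SigSub (mem_set FY)); apply: DefOver_mono.
  exact/stmono/jP.
have [k kP] := hP _ (stL j) F sF FDj.
have [i ji pi] := pP j k.
have famE : fam d i = F by rewrite /fam pi /=; case: pselect.
have [gi _] := good i; rewrite famE in gi.
exists (d i); first by right; exists i.
by apply: gi => // Y /FDj; apply: DefOver_mono; exact: stmono.
Qed.

End Closure.

(** * Vaughtian pairs and two-cardinal models *)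

Section Pairs.
Context (L : language) (C : structure L) (Kap : Type).
Implicit Types (A B M X Y : set C) (F : set (set C)).
Local Notation P := (P_of C).
Local Notation N := {n & formula L n}.

Lemma closed_P A : closed setT A -> closed P A.
Proof.
move=> cA X DX [x Px Xx]; have [||y [_ Ay [Py Xy]]] := cA (P `&` X).
- by apply: DefOver_and => //; exact: DefOverP.
- by exists x.
- by exists y.
Qed.

Lemma tp_not_algebraic M c : ~ M c -> ~ algebraic_over M (tp (fun _ : 'I_1 => c) M).
Proof.
move=> Mc [a [Ma ha]].
have /DefOver_pformula[psi [Mpsi hpsi]] := DefOver_neq (Ma ord0).
have : pholds setT psi a by apply: ha; split=> //; apply/hpsi => /= e;
    apply: Mc; rewrite e.
have -> : a = (fun=> a ord0) by apply/funext => i; rewrite ord1.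
by move/hpsi; apply.
Qed.

Lemma S_star_tp M c : P_tight M c -> S_star M (tp (fun _ : 'I_1 => c) M).
Proof.
move=> /P_tightP[cl Pc]; exists (fun=> c).
have -> : range (fun _ : 'I_1 => c) = [set c].
  by apply/seteqP; split=> [_ [_ _ <-] //|_ ->]; exists ord0.
split=> //; last exact/complete_closed.
by apply/seteqP; split=> x [Px];
    [case=> [|e]; split=> //; move: Px; rewrite e|split=> //; left].
Qed.

(** A solution exists in [N'], a model containing [c], and the elements of [P] in [N'] are already
    in [M]. *)
Lemma P_tight_extension M N' c : closed setT M -> closed setT N' -> M `<=` N' ->
  P `&` M = P `&` N' -> N' c -> P_tight M c.
Proof.
move=> cM cN MN PMN Nc D DD [y Py Dy].
have [||z [Pz Nz Dz]] := closed_P cN (X := fun y => D (fun b => if b then y else c)).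
- apply: Def_ext (Def_subst (fun b : bool =>
      if b then inl tt else inr (SigSub (mem_set Nc)))
    (Def_mono MN DD)) => v.
  by apply: eq_iff; congr D; apply/funext => -[].
- by exists y.
exists z; split=> //; have : (P `&` N') z by [].
by rewrite -PMN => -[].
Qed.

Lemma vaughtian_not_nulldimensional M N' :
  vaughtian_pair Kap M N' -> ~ nulldimensional C Kap.
Proof.
move=> [sM sN [MN _] neq PMN] null.
have [c [Nc Mc]] : exists c, N' c /\ ~ M c.
  apply: contrapT => h; apply: neq; apply/seteqP; split=> // x Nx.
  by apply: contrapT => Mx; apply: h; exists x.
have cM : closed setT M by apply/elementary_closed; case: sM.
have cN : closed setT N' by apply/elementary_closed; case: sN.
apply: (tp_not_algebraic Mc); apply: null => //; apply: S_star_tp.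
exact: P_tight_extension PMN Nc.
Qed.

(** A non-algebraic tuple has a coordinate outside [M], and tightness passes from the tuple to that
    coordinate. From here on single elements suffice. *)
Lemma not_nulldimensional_P_tight : ~ nulldimensional C Kap ->
  exists M c, [/\ closed setT M, ~ M c & P_tight M c].
Proof.
move=> h; apply: contrapT => no; apply: h => M sM k p [c [-> PMc cMc]].
have cM : closed setT M by apply/elementary_closed; case: sM.
apply: contrapT => nalg.
have [i Mi] : exists i, ~ M (c i).
  apply: contrapT => allM; apply: nalg; exists c; split=> [i|psi []//].
  by apply: contrapT => Mi; apply: allM; exists i.
apply: no; exists M, (c i); split=> // D DD [y Py Dy].
have [||z [Pz Az Dz]] :=
    (complete_closed _).1 cMc (fun y => D (fun b => if b then y else c i)).
- have ci : (M `|` range c) (c i) by right; exists i.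
  have Msub : M `<=` M `|` range c by left.
  apply: Def_ext (Def_subst (fun b : bool =>
      if b then inl tt else inr (SigSub (mem_set ci)))
    (Def_mono Msub DD)) => v.
  by apply: eq_iff; congr D; apply/funext => -[].
- by exists y.
exists z; split=> //; have : (P `&` (M `|` range c)) z by [].
by rewrite PMc => -[].
Qed.

Lemma lowenheim_skolem M A : closed setT M -> A `<=` M -> tle nat A -> tle N A ->
  exists M0, [/\ A `<=` M0, M0 `<=` M, closed setT M0 & tle M0 A].
Proof.
move=> cM AM natA NA.
have [m0 Am0] : A !=set0 by have [e _] := natA; exists (set_val (e 0)); exact: set_valP.
(* [None] marks the places of the free variable, so one list records both the parameters and where
   [x] occurs. *)
pose D (q : N * seq (option C)) : set C := [set x |
  holds setT (projT2 q.1) (fun i => odflt x (nth None q.2 i))].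
have /choice[sk skP] q : exists x, M x /\ ((exists2 y, M y & D q y) -> D q x).
  have [[y My Dy]|no] := pselect (exists2 y, M y & D q y); first by exists y.
  by exists m0; split; [exact: AM|].
pose step (H : set C) := H `|` [set x | exists q : N * seq (option C),
  (forall c, List.In (Some c) q.2 -> H c) /\ x = sk q].
pose H n := iter n step A.
have HS n m : n <= m -> H n `<=` H m.
  move=> /subnK <-; elim: (m - n) => [//|k IH] x /IH; rewrite addSn; by left.
have HM n : H n `<=` M.
  by elim: n => [//|n IH] x [/IH//|[q [_ ->]]]; have [] := skP q.
have HA n : tle (H n) A.
  elim: n => [|n IH]; first exact: tle_refl.
  apply: (@tle_trans _ (H n + N * seq (option (H n)))); last first.
    by apply: tle_sum_inf => //; apply: tle_prod_inf => //;
        apply: tle_seq_inf => //; apply: tle_option_inf.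
  apply: (tle_cover (f := fun x => match x with inl x => set_val x
    | inr (t, l) => sk (t, map (omap set_val) l) end)) => x [Hx|[[t l] [hl ->]]].
    by exists (inl (SigSub (mem_set Hx))).
  have [l' <-] : exists l' : seq (option (H n)), map (omap set_val) l' = l.
    elim: l hl => [|o l IHl] hl; first by exists [::].
    have [|l' <-] := IHl; first by move=> c lc; apply: hl; right.
    case: o hl => [c|] hl; last by exists (None :: l').
    have Hc : H n c by apply: hl; left.
    by exists (Some (SigSub (mem_set Hc)) :: l').
  by exists (inr (t, l')).
pose S := range H.
exists (\bigcup_(X in S) X); split.
- by move=> x Ax; exists (H 0) => //; exists 0.
- by move=> x [_ [n _ <-]]; apply: HM.
- move=> X DX [x _ Xx].
  have [||_ [n _ <-] [k [phi [s hs]]]] := DefOver_bigcup _ _ DX.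
  + by exists (H 0), 0.
  + move=> _ _ [n _ <-] [m _ <-]; have /orP[nm|mn] := leq_total n m;
        [left|right]; exact: HS.
  pose q : N * seq (option C) := (existT _ k phi,
    [seq (if s i is inr b then Some (set_val b) else None) | i <- enum 'I_k]).
  have DqX z : D q z <-> X z.
    rewrite (hs (fun=> z)) /D /=; apply: eq_iff; congr holds; apply/funext => i.
    by rewrite (nth_map i) ?size_enum_ord // nth_ord_enum; case: (s i).
  have [y [_ My Xy]] : exists y, [/\ setT y, M y & X y].
    apply: cM; last by exists x.
    apply: DefOver_mono DX => z [_ [m _ <-]]; exact: HM.
  exists (sk q); split=> //.
    exists (H n.+1); first by exists n.+1.
    right; exists q; split=> // c /List.in_map_iff[i [+ _]].
    by case: (s i) => // b [<-]; exact: set_valP.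
  by apply/DqX; apply: (skP q).2; exists y => //; apply/DqX.
apply: (@tle_trans _ (nat * A)); last first.
  by apply: tle_prod_inf => //; exact: tle_refl.
have /choice[n nP] (x : \bigcup_(X in S) X) : exists n, H n (set_val x).
  by have [_ [n _ <-]] := set_valP x; exists n.
pose f k := projT1 (cid (HA k)).
have fi k : injective (f k) by exact: projT2 (cid (HA k)).
exists (fun x => (n x, f (n x) (SigSub (mem_set (nP x))))).
move=> x y [exy]; move: (nP x) (nP y); rewrite exy => hx hy /fi[] /val_inj //.
Qed.

Lemma two_cardinal_vaughtian M : two_cardinal Kap M ->
  exists M0, vaughtian_pair Kap M0 M.
Proof.
move=> [sM NP [PM nMP]].
have cM : closed setT M by apply/elementary_closed; case: sM.
have NPM : tle N (P `&` M :> set C) by apply/card_leTP.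
have [|||M0 [PM0 M0M cM0 M0P]] := lowenheim_skolem (M := M) (A := P `&` M) cM.
- by move=> x [].
- exact: tle_trans (inj_formulas L) NPM.
- exact: NPM.
have eM : elementary M setT by case: sM.
have eM0 : elementary M0 setT by apply/elementary_closed.
exists M0; split=> //.
- split=> //; case: sM => _ [MK nKM]; split;
      first by apply: card_le_trans (subset_card_le M0M) MK.
  by move=> h; apply: nKM; apply: card_le_trans h (subset_card_le M0M).
- split=> // n phi v M0v; have Mv : tuple_in M v by move=> i; exact: M0M.
  by rewrite (eM0.2 _ _ _ M0v) (eM.2 _ _ _ Mv).
- by move=> e; apply: nMP; apply/card_tleP; move: M0P; rewrite e.
- by apply/seteqP; split=> x [Px Mx]; split=> //; [exact: M0M|apply: PM0].
Qed.

End Pairs.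

(** * Constructions that keep a saturated [P]-part of size [lambda] fixed *)

Section MainConstructions.
Context (L : language) (C : structure L) (Kap Lam : Type) (R : Lam -> Lam -> Prop).
Implicit Types (A B M X Y : set C) (F : set (set C)).
Local Notation P := (P_of C).
Local Notation N := {n & formula L n}.

Hypotheses (P_inf : infinite_set P)
  (C_sat : card_saturated [set: Kap] [set: C])
  (C_stably_embedded : P_stably_embedded C) (C_induced : P_induced_structure C)
  (sN : small Lam N)
  (Lam_pow : forall mu : set Lam, small Lam mu -> tle (mu -> Lam) Lam)
  (Rwo : strict_well_order R) (Rinit : forall i, small Lam [set j | R j i])
  (K : set Kap) (K_succ : card_succ K [set: Lam]) (K_lt : card_lt K [set: Kap]).

Let natN := inj_formulas L.
Let natL : tle nat Lam := natLam natN sN.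

Lemma tle_Lam_lt_Kap A : tle A Lam -> card_lt A [set: Kap].
Proof.
move=> AL; have LK : tle Lam K by apply/card_leTP; case: K_succ => -[].
have AK := tle_trans AL LK.
have [/card_leTr KK nKK] := K_lt; split; first by apply/card_leTr;
    apply: tle_trans AK KK.
by move=> /card_leTP KA; apply: nKK; apply/card_leTP; apply: tle_trans KA AK.
Qed.

Lemma realize A F : tle A Lam -> F `<=` @DefOver L C A -> fip setT F ->
  exists x, forall X, F X -> X x.
Proof.
move=> AL FA Ff.
have [//|X FX||x _ xF] := saturated_fip (F := F) C_sat (B := A) _ (tle_Lam_lt_Kap AL).
- have /DefOver_pformula[psi [Apsi h]] := FA _ FX.
  by exists psi; split=> // y _; apply: h.
- exact: Ff.
by exists x.
Qed.

Lemma small_DefOver B : small Lam B -> small Lam (@DefOver L C B).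
Proof.
move=> sB; have sUB := small_sum natN sN (small_fin natN sN unit) sB.
exact: small_le (DefOver_tle B) (small_prod natN sN sN (small_seq natN sN sUB)).
Qed.

Lemma small_set0 T : small Lam (@set0 T).
Proof.
apply: small_le (small_fin natN sN bool).
by exists (fun=> true) => x; have := set_valP x.
Qed.

Lemma small_set1 T (x : T) : small Lam [set x].
Proof.
apply: small_le (small_fin natN sN unit); exists (fun=> tt) => y z _.
by apply: val_inj; rewrite /= (set_valP y) (set_valP z).
Qed.

Lemma saturated_in_closed M : saturated_in Lam M -> closed setT M.
Proof.
move=> sM X DX [x _ Xx]; have [|_ -> //||y My yX] := sM [set X].
- exact: small_set1.
- move=> s sX; exists x => //; elim: sX => [//|_ s' -> _ IH]; by split.
by exists y; split=> //; exact: yX.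
Qed.

Lemma saturated_in_card U (Q : set U) Z M :
  (forall V (a : V), Def (@set0 C) (fun w => Z (w a))) -> closed Z M ->
  (forall B, card_lt B Q -> small Lam B) -> saturated_in Lam M ->
  card_saturated Q (Z `&` M).
Proof.
move=> DZ cM Qs sM; apply: saturated_of_fip => // B F BM BQ FB Ff.
apply: sM => //; last by move=> X /FB; apply: DefOver_mono.
by apply: small_sub FB (small_DefOver (Qs _ BQ)).
Qed.

Lemma fip_P_cofinite (D : set C) : fip setT (P |` [set ~` [set b] | b in D]).
Proof.
move=> s sF; suff [E finE hE] : exists2 E, finite_set E & P `\` E `<=` inter s.
  have /infinite_setN0[x hx] := infinite_setD P_inf finE.
  by exists x => //; apply: hE.
elim: sF => [|_ s' [->|[b Db <-]] _ [E finE hE]]; first by exists set0.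
  by exists E => // x [Px Ex]; split=> //; apply: hE.
exists (E `|` [set b]); first by rewrite finite_setU; split.
move=> x [Px nEx]; split; first by move=> e; apply: nEx; right.
by apply: hE; split=> // Ex; apply: nEx; left.
Qed.

(** Were [P^M] small, the requirement to lie in [P] and to differ from each element of [P^M] would
    be a small consistent family, realized in [M]. *)
Lemma saturated_in_P M : tle M Lam -> saturated_in Lam M -> P `&` M #= [set: Lam].
Proof.
move=> ML sM; rewrite card_eq_le; apply/andP; split.
  by apply/card_leTr; apply: tle_trans ML; apply/card_tleP/subset_card_le => x [].
apply/card_leTP; apply: contrapT => sPM.
have [|||x Mx xF] := sM (P |` [set ~` [set b] | b in P `&` M]).
- have sD : small Lam [set ~` [set b] | b in P `&` M].
    apply: small_le sPM.
    apply: (tle_cover (f := fun b : P `&` M => ~` [set set_val b])) => _ [b PMb <-].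
    by exists (SigSub (mem_set PMb)).
  exact (small_setU natN sN (@small_set1 _ P) sD).
- by move=> _ [->|[b [_ Mb] <-]]; [exact: DefOverP|exact: DefOver_neq].
- exact: fip_P_cofinite.
have Px : P x by apply: (xF P); left.
have : (~` [set x]) x by apply: xF; right; exists x.
exact.
Qed.

Section Chain.
Variable M0 : set C.
Hypotheses (M0L : tle M0 Lam) (M0sat : saturated_in Lam M0).
Hypothesis winT : forall G, wins G [set: C].

Let PM0 : P `&` M0 #= [set: Lam] := saturated_in_P M0L M0sat.

Lemma card_lt_eqr_small T (A : set T) U (B : set U) : A #= [set: Lam] ->
    card_lt B A -> small Lam B.
Proof.
rewrite card_eq_le => /andP[AL LA] [BA nAB] LB; apply: nAB.
by apply: card_le_trans AL _; apply/card_leTP.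
Qed.

Lemma saturated_PM0 : saturated (P `&` M0).
Proof.
apply: saturated_in_card => //; first by move=> V a; exact: Def_P.
- exact/closed_P/saturated_in_closed.
- by move=> B; apply: card_lt_eqr_small.
Qed.

(** This invariant survives unions of chains, and it lends the saturation of [P^M0] to sets that are
    not models. *)
Let Q X := closed P X /\ P `&` X = P `&` M0.

Lemma Q_P_sat X : Q X -> P_sat Lam X.
Proof.
move=> [cX PX]; apply: P_sat_saturated => //; rewrite PX //; exact: saturated_PM0.
Qed.

Lemma Q_neq0 X : Q X -> X !=set0.
Proof.
move=> [_ PX]; have [e _] := natL.
have : tle Lam (P `&` M0 :> set C) by apply/card_leTP; move: PM0;
    rewrite card_eq_le => /andP[].
move=> [f _]; have [x] : exists x, (P `&` M0) x.
  by exists (set_val (f (e 0))); exact: set_valP.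
by rewrite -PX => -[_ Xx]; exists x.
Qed.

Lemma Q_tight X c : Q X -> P_tight X c -> Q (X `|` [set c]).
Proof.
move=> [cX PX] /P_tightP[cXc Pc]; split=> //; rewrite -PX.
by apply/seteqP; split=> x [Px];
    [case=> [|e]; split=> //; move: Px; rewrite e|split=> //; left].
Qed.

Lemma Q_proper X : Q X -> tle X Lam -> exists2 c, ~ X c & P_tight X c.
Proof.
move=> QX XL.
have [|s|c [_ tc /(_ isT) nc]] :=
    P_tight_realization sN Rwo Rinit realize (F0 := set0) (nal := true)
    QX.1 XL (Q_P_sat QX) (Q_neq0 QX) (@small_set0 _).
- by [].
- by case=> [|? ? []] G _; exact: winT.
by exists c.
Qed.

Lemma Q_bigcup (S : set (set C)) : S !=set0 -> S `<=` Q -> total_on S subset ->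
  Q (\bigcup_(X in S) X).
Proof.
move=> [X0 SX0] SQ tot; split.
  by apply: closed_bigcup => //; [exists X0|move=> Y /SQ[]].
apply/seteqP; split=> x [Px].
  by move=> [Y SY Yx]; have [_ <-] := SQ _ SY; split.
move=> Mx; have [_ PX0] := SQ _ SX0; have : (P `&` M0) x by [].
by rewrite -PX0 => -[_ X0x]; split=> //; exists X0.
Qed.

Lemma Q_extend X : Q X -> tle X Lam ->
  exists M, [/\ X `<=` M, Q M, tle M Lam & saturated_in Lam M].
Proof.
move=> QX XL; apply: (saturation_closure sN Lam_pow Rwo Rinit) => //.
- move=> Y F QY YL sF FY Ff.
  have [//|s sF' G /= aG|c [cF tc _]] :=
      P_tight_realization sN Rwo Rinit realize (F0 := F) (nal := false)
    QY.1 YL (Q_P_sat QY) (Q_neq0 QY) sF.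
    by apply: wins_pos => //; have [x _ sx] := Ff s sF'; exists x.
  by exists c => //; exact: Q_tight.
- exact: Q_bigcup.
Qed.

Lemma Q_M0 : Q M0.
Proof. by split=> //; exact/closed_P/saturated_in_closed. Qed.

(* The union U of a maximal chain of saturated sets of size at most |Lam|: if
   A is not inside a member of the chain, the members containing elements of A
   are cofinal, so |U| <= |A||Lam|. *)
Lemma long_chain : exists U, [/\ Q U, saturated_in Lam U, small U Lam &
  forall A, A `<=` U -> ~ tle U A -> tle A Lam].
Proof.
pose nice X := [/\ Q X, tle X Lam & saturated_in Lam X].
have [S1 SP|S [[Snice Stot] Smax]] := @Zorn_bigcup _
    (fun S : set (set C) => S `<=` nice /\ total_on S subset).
  move=> S1tot; split; first by move=> X [S /SP[Sn _]]; apply: Sn.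
  move=> X Y [S SS SX] [S' SS' SY].
  have [h|h] := S1tot _ _ SS SS'; first by apply: (SP _ SS').2 => //; apply: h.
  by apply: (SP _ SS).2 => //; apply: h.
have S0 : S !=set0.
  apply: contrapT => /set0P/negP/negPn/eqP S0; apply: (Smax [set M0]).
    by rewrite S0; split=> // /(_ M0); apply.
  split; first by move=> _ ->; split=> //; exact: Q_M0.
  by move=> _ _ -> ->; left.
pose U := \bigcup_(X in S) X.
have QU : Q U by apply: Q_bigcup => // X /Snice[].
(* Otherwise a new element is added to [U] and the result saturated again, which prolongs the
   maximal chain. *)
have nUL : ~ tle U Lam.
  move=> UL; have [c Uc tc] := Q_proper QU UL.
  have UcL : tle (U `|` [set c]) Lam by exact: tle_setU1.
  have [M [UM QM ML sM]] := Q_extend (Q_tight QU tc) UcL.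
  have MS X : S X -> X `<=` M by move=> SX x Xx; apply: UM; left; exists X.
  apply: (Smax (S `|` [set M])).
    split; first by move=> X; left.
    move=> h; apply: Uc; exists M; first by apply: h; right.
    by apply: UM; right.
  split; first by move=> X [/Snice//|->].
  move=> X Y [SX|->] [SY|->]; [exact: Stot|by left; apply: MS|by right;
      apply: MS|by left].
have dich B : B `<=` U -> (exists2 X, S X & B `<=` X) \/ tle U (B * Lam).
  move=> BU; have [|nb] := pselect (exists2 X, S X & B `<=` X); [by left|right].
  have /choice[f fP] (b : B) : exists X, S X /\ X (set_val b).
    by have [X SX Xb] := BU _ (set_valP b); exists X.
  have cof (x : U) : exists b, f b (set_val x).
    have [X SX Xx] := set_valP x; apply: contrapT => h; apply: nb; exists X => // b Bb.
    have [Sf fb] := fP (SigSub (mem_set Bb)).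
    have [fX|Xf] := Stot _ _ Sf SX; first exact: fX fb.
    by case: h; exists (SigSub (mem_set Bb)); apply: Xf.
  have [b bP] := choice cof.
  have fL c : tle (f c) Lam by have [/Snice[]] := fP c.
  pose g c := projT1 (cid (fL c)).
  have gi c : injective (g c) by exact: projT2 (cid (fL c)).
  exists (fun x => (b x, g (b x) (SigSub (mem_set (bP x))))).
  by move=> x y [exy]; move: (bP x) (bP y); rewrite exy => hx hy /gi[] /val_inj.
exists U; split=> //.
- move=> F sF FU Ff.
  (* [t Y] holds the parameters of [Y]. The union of these sets has size at most [|Lam|], so by
     [dich] it lies in one member of the chain, which is saturated. *)
  have /choice[t tP] (Y : F) : exists B : set C,
      [/\ B `<=` U, tle B nat & DefOver B (set_val Y)].
    have /DefOver_pformula[psi [Upsi hpsi]] := FU _ (set_valP Y).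
    exists (range (params psi)); split.
    - by move=> _ [i _ <-]; apply: Upsi.
    - apply: (@tle_trans _ 'I_(nparam psi)); last by exists val; exact: val_inj.
      by apply: (tle_cover (f := params psi)) => x [i _ <-]; exists i.
    - by apply/DefOver_pformula; exists psi; split=> // i; exists i.
  pose B := \bigcup_(Y in [set: F]) t Y.
  have BL : tle B Lam.
    by apply: small_leL; apply: (small_bigcup natN sN sF) => Y; have [] := tP Y.
  have BU : B `<=` U by move=> x [Y _ tYx]; have [h _ _] := tP Y; exact: h.
  have [[X SX BX]|UBL] := dich B BU; last first.
    by case: nUL; apply: tle_trans UBL _; apply: tle_prod_inf => //; exact: tle_refl.
  have [_ _ sX] := Snice _ SX.
  have [|c Xc cF] := sX F sF _ Ff.
    move=> Y FY; have [_ _] := tP (SigSub (mem_set FY)); apply: DefOver_mono => x tx.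
    by apply: BX; exists (SigSub (mem_set FY)).
  by exists c => //; exists X.
- move=> A AU nUA; have [[X SX AX]|UAL] := dich A AU.
    have [_ XL _] := Snice _ SX; apply: tle_trans XL.
    exact/card_tleP/subset_card_le.
  have [//|LA] := tle_total A Lam; case: nUA.
  apply: tle_trans UAL _; apply: tle_prod_inf (tle_trans natL LA) (tle_refl _) LA.
Qed.

End Chain.

Lemma submodel_of A : closed setT A -> card_lt A [set: Kap] -> submodel Kap A.
Proof. by move=> cA AK; split=> //; apply/elementary_closed. Qed.

Hypothesis not_null : ~ nulldimensional C Kap.

(** The game is evaluated in [C], so the model that witnesses non-nulldimensionality need not be
    related to the saturated sets built elsewhere. *)
Lemma all_win G : wins G [set: C].
Proof.
have [M [c [cM Mc tc]]] := not_nulldimensional_P_tight not_null.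
by apply: (wins_witness G cM Mc tc) => //; exact: DefOverT.
Qed.

Lemma saturated_model : exists2 M0 : set C, tle M0 Lam & saturated_in Lam M0.
Proof.
have [|||M [_ _ ML sM]] := saturation_closure sN Lam_pow Rwo Rinit (Q :=
    fun=> True) (A := @set0 C) _ _ I.
- move=> X F _ XL sF FX Ff; have [x xF] := realize XL FX Ff; by exists x.
- by [].
- exact/small_leL/small_set0.
by exists M.
Qed.

Lemma saturated_model_nonalgebraic : exists M : set C, [/\ submodel Kap M, saturated M &
  exists k (p : set (pformula C k)), S_star M p /\ ~ algebraic_over M p].
Proof.
have [M ML sM] := saturated_model.
have cM := saturated_in_closed sM.
have [c Mc tc] := Q_proper ML sM all_win (Q_M0 sM) ML.
exists M; split; first exact: submodel_of cM (tle_Lam_lt_Kap ML).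
- rewrite /saturated -[X in card_saturated _ X]setTI; apply: saturated_in_card => //.
    by move=> V a; exact: Def_true.
  move=> B; apply: card_lt_eqr_small.
  have := saturated_in_P ML sM; rewrite !card_eq_le => /andP[_ LP]; apply/andP; split.
    exact/card_leTr.
  by apply: card_le_trans LP _; apply: subset_card_le => x [].
- exists 1, (tp (fun=> c) M); split; first exact: S_star_tp.
  exact: tp_not_algebraic.
Qed.

Lemma vaughtian_pair_saturated : exists M N' : set C, [/\ vaughtian_pair Kap M N',
  saturated (P `&` M) & P `&` M #= [set: Lam]].
Proof.
have [M ML sM] := saturated_model.
have cM := saturated_in_closed sM.
have [c Mc tc] := Q_proper ML sM all_win (Q_M0 sM) ML.
have McL : tle (M `|` [set c]) Lam by exact: tle_setU1.
have [N' [McN [_ PN] NL sN']] := Q_extend ML sM (Q_tight (Q_M0 sM) tc) McL.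
have cN := saturated_in_closed sN'.
have MN : M `<=` N' by move=> x Mx; apply: McN; left.
exists M, N'; split.
- split=> //; [exact: submodel_of cM (tle_Lam_lt_Kap ML)|exact: submodel_of cN
      (tle_Lam_lt_Kap NL)| |].
    split=> // n phi v Mv; have Nv : tuple_in N' v by move=> i; exact: MN.
    have [_ eM] := (elementary_closed _).2 cM; have [_ eN] :=
        (elementary_closed _).2 cN.
    by rewrite (eM _ _ _ Mv) (eN _ _ _ Nv).
  by move=> e; apply: Mc; rewrite e; apply: McN; right.
- exact: saturated_PM0.
- exact: saturated_in_P.
Qed.

Lemma large_two_cardinal_model : exists M : set C, [/\ two_cardinal Kap M,
  of_type_succ Lam M, saturated (P `&` M) & card_saturated [set: Lam] M].
Proof.
have [M0 M0L sM0] := saturated_model.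
have [U [[cPU PU] sU nUL succU]] := long_chain M0L sM0 all_win.
have cU := saturated_in_closed sU.
have PM0 := saturated_in_P M0L sM0; have := PM0; rewrite card_eq_le => /andP[PL LP].
(* [K] has size [lambda^+]. A copy of [K] inside [U] exceeds [lambda], so by [succU] it is as large
   as [U]. This keeps [U] below [|Kap|], as a submodel must be. *)
have UK : tle U K.
  have [//|[f fi]] := tle_total U K.
  have [KL nKL] : card_lt [set: Lam] K by case: K_succ.
  apply: contrapT => nUK; apply: nKL; apply/card_leTr.
  pose A := [set set_val (f x) | x in [set: K]].
  have KA : tle K A.
    have h x : A (set_val (f x)) by exists x.
    by exists (fun x => SigSub (mem_set (h x))) => x y [/val_inj/fi].
  have AK : tle A K by apply: (tle_cover (f := fun x => set_val (f x))) =>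
      _ [x _ <-]; exists x.
  apply: tle_trans KA _; apply: succU; first by move=> _ [x _ <-]; exact: set_valP.
  by move=> UA; apply: nUK; apply: tle_trans UA AK.
have LU : tle Lam U by have [//|] := tle_total Lam U.
have ltLU : card_lt [set: Lam] U by split; [exact/card_leTP|move/card_leTr].
exists U; split.
- split.
  + apply: submodel_of => //; have [/card_leTr KK nKK] := K_lt; split.
      by apply/card_leTr; apply: tle_trans UK KK.
    by move=> /card_leTP KU; apply: nKK; apply/card_leTP; apply: tle_trans KU UK.
  + rewrite PU; apply: card_le_trans LP; rewrite /formulas card_leTT; exact: small_leL.
  + rewrite PU; split; first by apply: card_le_trans PL ltLU.1.
    by move=> h; apply: ltLU.2; apply: card_le_trans h PL.
- split; first by rewrite PU.
  split=> // A AU [_ nUA]; apply/card_leTr; apply: succU => //.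
  by move=> h; apply: nUA; apply/card_tleP.
- rewrite PU; exact: saturated_PM0.
- rewrite -[U]setTI; apply: saturated_in_card => //; first by move=> V a;
      exact: Def_true.
  by move=> B /small_ltsP.
Qed.

End MainConstructions.

Theorem theorem9p11 (L : language) (T : theory L) (Kap : Type)
    (C : structure L) (Lam : Type)
    (T_complete : complete_theory T)
    (T_P_infinite : implies_P_infinite T)
    (C_monster : monster T Kap C)
    (C_stably_embedded : P_stably_embedded C)
    (C_induced : P_induced_structure C)
    (T_qe : quantifier_elimination T)
    (lt_T_lam : card_lt (formulas L) [set: Lam])
    (lam_pow : card_eq_weak_power Lam)
    (* lambda^+ is small with respect to the monster model *)
    (Kap_large : exists K : set Kap,
       card_succ K [set: Lam] /\ card_lt K [set: Kap]) :
  [<-> ~ nulldimensional C Kap;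
       exists M : set C, [/\ submodel Kap M, saturated M &
         exists k (p : set (pformula C k)), S_star M p /\ ~ algebraic_over M p];
       exists M N : set C, vaughtian_pair Kap M N;
       exists M N : set C, [/\ vaughtian_pair Kap M N,
         saturated (P_of C `&` M) & P_of C `&` M #= [set: Lam]];
       exists M : set C, two_cardinal Kap M /\ card_lt (formulas L) M;
       exists M : set C, two_cardinal Kap M /\ saturated (P_of C `&` M);
       exists M : set C, [/\ two_cardinal Kap M, of_type_succ Lam M &
         saturated (P_of C `&` M)];
       exists M : set C, [/\ two_cardinal Kap M, of_type_succ Lam M &
         card_saturated [set: Lam] M]].
Proof.
have [K [K_succ K_lt]] := Kap_large; have [C_model C_sat _] := C_monster.
have sN : small Lam {n & formula L n} by apply/small_ltP.
have Lam_pow (mu : set Lam) : small Lam mu -> tle (mu -> Lam) Lam.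
  by move=> /small_ltsP/(lam_pow.1)/card_leTT.
have [R [Rwo Rinit]] := initial_well_order Lam.
have P_inf := T_P_infinite C C_model.
have big := large_two_cardinal_model P_inf C_sat C_stably_embedded C_induced sN
  Lam_pow Rwo Rinit K_succ K_lt.
(* Each statement about a two-cardinal model leads back to non-nulldimensionality, from which [big]
   gives one model with all the properties asked for later. *)
have two (M : set C) : two_cardinal Kap M -> ~ nulldimensional C Kap.
  by move=> /two_cardinal_vaughtian[M0 v]; exact (vaughtian_not_nulldimensional v).
have big5 : ~ nulldimensional C Kap -> exists M : set C, two_cardinal Kap M /\
    card_lt (formulas L) M.
  move=> /big[M [M2 [PM [[LM nML] _]] _ _]]; exists M; split=> //.
  have [TL nLT] := lt_T_lam; split; first exact: card_le_trans TL LM.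
  by move=> h; apply: nML; apply: card_le_trans h TL.
tfae.
- exact: (saturated_model_nonalgebraic P_inf C_sat C_stably_embedded C_induced sN
    Lam_pow Rwo Rinit K_succ K_lt).
- move=> [M [sM _ [k [p [Sp np]]]]].
  have [|M1 [N1 [v _ _]]] :=
      vaughtian_pair_saturated P_inf C_sat C_stably_embedded C_induced sN
    Lam_pow Rwo Rinit K_succ K_lt.
    by move=> null; apply: np; apply: null.
  by exists M1, N1.
- move=> [M [N /vaughtian_not_nulldimensional]].
  exact: (vaughtian_pair_saturated P_inf C_sat C_stably_embedded C_induced sN
    Lam_pow Rwo Rinit K_succ K_lt).
- by move=> [M [N [/vaughtian_not_nulldimensional/big5]]].
- by move=> [M [/two/big[M' [? _ ? _]] _]]; exists M'.
- by move=> [M [/two/big[M' [? ? ? _]] _]]; exists M'.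
- by move=> [M [/two/big[M' [? ? _ ?]] _ _]]; exists M'.
- by move=> [M [/two]].
Qed.
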